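(* Let $\mathbf K$ be $\mathbf H$ or $\mathbf O$. If the boundary $\partial U$ of an open domain $U$ in $\mathbf K$ contains a pseudoconformal hypersurface $S$, and if $f:U\to\mathbf K$ is a pseudoconformal function such that $\lim_{z\to\zeta}f'(z)\neq0$ for each $\zeta\in S$, then $f$ has a pseudoconformal extension through $S$.
   Context: $\mathbf K$ is the quaternion skew field $\mathbf H$ ($r=2$) or the octonion algebra $\mathbf O$ ($r=3$); $\tilde z=z^*$ is the conjugate, $|z|^2=z\tilde z$, $\mathrm{Re}(z)=(z+\tilde z)/2$. Functions of $z$ are represented by phrases (finite or convergent infinite sums of bracketed words in $z$, $\tilde z$ and constants of $\mathbf K$); $\partial f/\partial z$ and $\partial f/\partial\tilde z$ are the partial (super)derivatives, $\mathbf R$-linear operators whose sum is the Fréchet derivative. A differentiable $f:U\to\mathbf K$ is pseudoconformal at $\xi\in U$ if (1) $\partial f(z)/\partial\tilde z=0$ at $z=\xi$; (2) writing $f'(\xi)=(\partial f/\partial z)|_{z=\xi}$, $\mathrm{Re}\{[f'(\xi).h_1][f'(\xi).h_2]^*\}|h_1||h_2|=|f'(\xi).h_1||f'(\xi).h_2|\,\mathrm{Re}(h_1\tilde h_2)$ for all $h_1,h_2\in\mathbf K$; (3) $f'(\xi)\neq0$; where nonproper rotations of the underlying space $\mathbf R^{2^r}$ associated with $f'$ are excluded. $f$ is pseudoconformal on $U$ if it is so at each point of $U$. Pseudoconformal hypersurface: let $V$ be an open domain in $\mathbf K$ and $g:V\to\mathbf K$ a pseudoconformal diffeomorphism onto $g(V)$;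 let $\pi$ be a hyperplane or a hypersphere over $\mathbf R$ embedded into $\mathbf K$ such that $p:=V\cap\pi$ is open in $\pi$. Then $S=g(p)$ is called a pseudoconformal hypersurface in $\mathbf K$. *)

(* Defs.v *)
From HB Require Import structures.
From mathcomp Require Import all_boot all_order all_algebra.
From mathcomp Require Import all_classical all_reals all_analysis.

Set Implicit Arguments.
Unset Strict Implicit.
Unset Printing Implicit Defensive.

Import Order.TTheory GRing.Theory Num.Theory.
Import numFieldNormedType.Exports.

Local Open Scope classical_set_scope.
Local Open Scope ring_scope.

Fixpoint cd_dim (r : nat) : nat :=
  if r is r'.+1 then (cd_dim r' + cd_dim r')%N else 1%N.

(* The Cayley-Dickson algebra of real dimension [2 ^ r]: the quaternions for
   [r = 2], the octonions for [r = 3].  An element of level [r.+1] is the row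
   [(a, b)] of two elements of level [r].  Its canonical topology is that of the
   coordinatewise maximum norm; the modulus [|z|] is [cd_abs] below. *)
Notation CD R r := 'rV[R]_(cd_dim r).

Fixpoint cd_one (R : realType) (r : nat) : CD R r :=
  if r is r'.+1 then row_mx (cd_one R r') 0 else 1%:M.

Fixpoint cd_conj (R : realType) (r : nat) : CD R r -> CD R r :=
  if r is r'.+1 then
    fun z : 'rV[R]_(cd_dim r' + cd_dim r') =>
      row_mx (cd_conj (lsubmx z)) (- rsubmx z)
  else id.

(* (a, b) (c, d) = (a c - d^* b, d a + b c^* ) *)
Fixpoint cd_mul (R : realType) (r : nat) : CD R r -> CD R r -> CD R r :=
  if r is r'.+1 then
    fun x y : 'rV[R]_(cd_dim r' + cd_dim r') =>
      let: a := lsubmx x in let: b := rsubmx x in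
      let: c := lsubmx y in let: d := rsubmx y in
      row_mx (cd_mul a c - cd_mul (cd_conj d) b)
             (cd_mul d a + cd_mul b (cd_conj c))
  else fun x y => x *m y.

Fixpoint cd_re (R : realType) (r : nat) : CD R r -> R :=
  if r is r'.+1 then
    fun z : 'rV[R]_(cd_dim r' + cd_dim r') => cd_re (lsubmx z)
  else fun z => z 0 0.

Lemma cd_reE (R : realType) (r : nat) (z : CD R r) :
  z + cd_conj z = (2 * cd_re z) *: cd_one R r.
Proof.
elim: r z => [|r IHr] z /=.
  by apply/rowP => i; rewrite ord1 !mxE eqxx mulr1 mulr_natl mulr2n.
by rewrite -{1}[z](@hsubmxK _ 1 (cd_dim r) (cd_dim r)) add_row_mx IHr addrN
  scale_row_mx scaler0.
Qed.

Definition cd_abs (R : realType) (r : nat) (z : CD R r) : R :=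
  Num.sqrt (cd_re (cd_mul z (cd_conj z))).

(* Bracketed words in the letters [z], [z~] and the constants of the algebra. *)
Inductive cd_word (R : realType) (r : nat) : Type :=
| WVar
| WConj
| WCst of CD R r
| WMul of cd_word R r & cd_word R r.

Fixpoint word_eval (R : realType) (r : nat) (w : cd_word R r) (z : CD R r) :
    CD R r :=
  match w with
  | WVar => z
  | WConj => cd_conj z
  | WCst c => c
  | WMul u v => cd_mul (word_eval u z) (word_eval v z)
  end.

(* The partial superderivatives of a word: the derivations with
   dz/dz.h = h, dz~/dz = 0 and dz/dz~ = 0, dz~/dz~.h = h~. *)
Fixpoint word_dz (R : realType) (r : nat) (w : cd_word R r) (z h : CD R r) :
    CD R r :=
  match w with
  | WVar => h
  | WConj => 0
  | WCst _ => 0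
  | WMul u v => cd_mul (word_dz u z h) (word_eval v z)
                + cd_mul (word_eval u z) (word_dz v z h)
  end.

Fixpoint word_dzb (R : realType) (r : nat) (w : cd_word R r) (z h : CD R r) :
    CD R r :=
  match w with
  | WVar => 0
  | WConj => cd_conj h
  | WCst _ => 0
  | WMul u v => cd_mul (word_dzb u z h) (word_eval v z)
                + cd_mul (word_eval u z) (word_dzb v z h)
  end.

(* The phrase [nu] is the sum of the words [nu 0], [nu 1], ...  in the variable
   [z - a], absolutely convergent on the open ball of centre [a] and radius
   [rho].  Finite sums are padded with [WCst 0].  The modulus of a word with
   all its constants collected is |c| |z - a| ^ deg, so that the differentiated
   sums converge absolutely on the same ball.  A finite phrase in the variable
   [z] itself is the case [a = 0], with any radius. *)
Definition phrase_cvg (R : realType) (r : nat) (nu : nat -> cd_word R r)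
    (a : CD R r) (rho : R) : Prop :=
  forall z : CD R r, cd_abs (z - a) < rho ->
    cvgn (series (fun n => cd_abs (word_eval (nu n) (z - a)))).

(* [f] is given near each point of [U] by a phrase, of which [dz] and [dzb] are
   the partial superderivatives df/dz and df/dz~ there; their sum is the Frechet
   derivative.  The same function has several phrases (z~ is itself a sum of
   words in z), so df/dz and df/dz~ are data attached to [f] rather than
   functions of [f]. *)
Definition superderivatives (R : realType) (r : nat) (U : set (CD R r))
    (f : CD R r -> CD R r) (dz dzb : CD R r -> CD R r -> CD R r) : Prop :=
  (forall xi, U xi -> exists (nu : nat -> cd_word R r) (a : CD R r) (rho : R),
     [/\ cd_abs (xi - a) < rho, phrase_cvg nu a rho &
       \forall z \near xi,
         (series (fun n => word_eval (nu n) (z - a)) @ \oo --> f z) /\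
         (forall h : CD R r,
            (series (fun n => word_dz (nu n) (z - a) h) @ \oo --> dz z h) /\
            (series (fun n => word_dzb (nu n) (z - a) h) @ \oo --> dzb z h))])
  /\ (forall xi, U xi -> differentiable f xi /\
        (forall h, 'd f xi h = dz xi h + dzb xi h)).

(* [dz] and [dzb] are here the operators (df/dz)(xi) and (df/dz~)(xi).  By the
   second and third conditions [dz] is a similarity of the underlying Euclidean
   space; the sign of its determinant tells proper rotations from nonproper
   ones. *)
Definition pseudoconformal_at (R : realType) (r : nat)
    (dz dzb : CD R r -> CD R r) : Prop :=
  [/\ forall h, dzb h = 0,
      forall h1 h2,
        cd_re (cd_mul (dz h1) (cd_conj (dz h2))) * (cd_abs h1 * cd_abs h2)
        = cd_abs (dz h1) * cd_abs (dz h2) * cd_re (cd_mul h1 (cd_conj h2)),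
      exists h, dz h != 0 &
      0 < \det (lin1_mx dz)].

(* [f] is pseudoconformal on [U], with derivative [f' z = df/dz] at [z]. *)
Definition pseudoconformal (R : realType) (r : nat) (U : set (CD R r))
    (f : CD R r -> CD R r) (f' : CD R r -> CD R r -> CD R r) : Prop :=
  exists2 dzb : CD R r -> CD R r -> CD R r,
    superderivatives U f f' dzb &
    forall xi, U xi -> pseudoconformal_at (f' xi) (dzb xi).

Definition domain (R : realType) (r : nat) (U : set (CD R r)) : Prop :=
  [/\ open U, connected U & U !=set0].

Definition hyperplane (R : realType) (r : nat) (P : set (CD R r)) : Prop :=
  exists (n : CD R r) (c : R),
    n != 0 /\ P = [set z | cd_re (cd_mul z (cd_conj n)) = c].

Definition hypersphere (R : realType) (r : nat) (P : set (CD R r)) : Prop :=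
  exists (a : CD R r) (rho : R),
    0 < rho /\ P = [set z | cd_abs (z - a) = rho].

Definition diffeomorphism (R : realType) (r : nat) (V : set (CD R r))
    (g : CD R r -> CD R r) : Prop :=
  [/\ open (g @` V),
      forall z, V z -> differentiable g z &
      exists2 ginv : CD R r -> CD R r,
        forall z, V z -> ginv (g z) = z &
        forall w, (g @` V) w -> differentiable ginv w].

Definition pseudoconformal_hypersurface (R : realType) (r : nat)
    (S : set (CD R r)) : Prop :=
  exists (V : set (CD R r)) (g : CD R r -> CD R r)
         (g' : CD R r -> CD R r -> CD R r) (P : set (CD R r)),
    [/\ domain V, pseudoconformal V g g', diffeomorphism V g,
        hyperplane P \/ hypersphere P &
        open (V `&` P : set (subspace P)) /\ S = g @` (V `&` P)].

Definition boundary (R : realType) (r : nat) (U : set (CD R r)) :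
    set (CD R r) :=
  closure U `\` interior U.

(* [f'] tends, as [z] in [U] tends to [zeta], to a nonzero R-linear operator
   (operators are written as matrices acting on rows). *)
Definition nonzero_limit_at (R : realType) (r : nat) (U : set (CD R r))
    (f' : CD R r -> CD R r -> CD R r) (zeta : CD R r) : Prop :=
  exists2 L : 'M[R]_(cd_dim r), L != 0 &
    lin1_mx (f' z) @[z --> within U (nbhs zeta)] --> L.

(* Main.v *)
(* Pseudoconformal functions are locally sums of absolutely convergent series of
   words, hence smooth, and their derivatives are orientation preserving
   similarities; since the real dimension is 4 or 8, Liouville's theorem makes
   [f] the restriction of a Moebius map: an affine similarity, or
   [b + c |z - p|^-2 (z - p) B] with [B] orthogonal.  Liouville's theorem is
   proved following Nevanlinna.  If [rho] is the inverse of the scale of the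
   similarity ['d f], then [rho f_hk + rho_h f_k + rho_k f_h = <h, k> w] with
   [w] the derivative of [f] along the gradient of [rho].  For pairwise orthogonal
   [h], [k], [l], the third derivative [(rho f)_hkl] computed in two ways gives
   [rho_hk = 0]; so the Hessians of [rho] and of [rho f] are multiples of the
   identity, and these multiples are constant.
     The Moebius map is defined off its pole [p], and [p] is not in [S] because
   ['d f] is unbounded near [p].  It is again a sum of words: [(z - p)^-1] is a
   geometric series, whose convergence only needs [x (x^-1 y) = y], and
   composition with a linear map stays within sums of words because every
   [R]-linear map is a finite sum of words. *)
Require Import Defs.
From HB Require Import structures.
From mathcomp Require Import all_boot all_order all_algebra.
From mathcomp Require Import all_classical all_reals all_analysis.
From mathcomp Require Import ring lra.

Set Implicit Arguments.
Unset Strict Implicit.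
Unset Printing Implicit Defensive.

Import Order.TTheory GRing.Theory Num.Theory.
Import numFieldNormedType.Exports.

Local Open Scope classical_set_scope.
Local Open Scope ring_scope.

(** * Cayley-Dickson algebras *)

Section CayleyDickson.
Variable R : realType.
Implicit Type r : nat.

(** Two obstacles shape the proof. Octonions are not associative, so products are handled only
    through what survives: brackets may be moved and factors rotated under the real part, and
    [x~ (x y) = |x|^2 y]. Together these give [|x y| = |x| |y|], which reduces estimates on words to
    estimates on real polynomials with nonnegative coefficients. The second obstacle is that [df/dz]
    and [df/dz~] belong to a phrase and not to the function. The extension is therefore built from
    words without [z~], so that [df/dz~ = 0] term by term and [df/dz] is the Frechet derivative;
    this is why even conjugation has to be rewritten in words in [z] alone. The orientation
    condition spreads from one point of [U]: the derivative of an affine map is constant, and for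
    the inversion the determinant is [- (c / |z - p|^2)^n det B], with [n] the real dimension, of
    constant sign off the pole. *)

Definition dot n (x y : 'rV[R]_n) : R := \sum_i x 0 i * y 0 i.

Lemma dotC n (x y : 'rV[R]_n) : dot x y = dot y x.
Proof. by apply: eq_bigr => i _; rewrite mulrC. Qed.

Lemma dotDl n (x y z : 'rV[R]_n) : dot (x + y) z = dot x z + dot y z.
Proof. by rewrite -big_split; apply: eq_bigr => i _; rewrite mxE mulrDl. Qed.

Lemma dotZl n a (x z : 'rV[R]_n) : dot (a *: x) z = a * dot x z.
Proof. by rewrite mulr_sumr; apply: eq_bigr => i _; rewrite mxE mulrA. Qed.

Lemma dotNl n (x z : 'rV[R]_n) : dot (- x) z = - dot x z.
Proof. by rewrite -scaleN1r dotZl mulN1r. Qed.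

Lemma dotDr n (x y z : 'rV[R]_n) : dot z (x + y) = dot z x + dot z y.
Proof. by rewrite !(dotC z) dotDl. Qed.

Lemma dotZr n a (x z : 'rV[R]_n) : dot z (a *: x) = a * dot z x.
Proof. by rewrite !(dotC z) dotZl. Qed.

Lemma dotNr n (x z : 'rV[R]_n) : dot z (- x) = - dot z x.
Proof. by rewrite !(dotC z) dotNl. Qed.

Lemma dot0l n (z : 'rV[R]_n) : dot 0 z = 0.
Proof. by rewrite -(scale0r z) dotZl mul0r. Qed.

Lemma dot_ge0 n (x : 'rV[R]_n) : 0 <= dot x x.
Proof. by apply: sumr_ge0 => i _; rewrite -expr2 sqr_ge0. Qed.

Lemma dot_eq0 n (x : 'rV[R]_n) : (dot x x == 0) = (x == 0).
Proof.
apply/eqP/eqP => [/eqP|->]; last by rewrite dot0l.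
rewrite psumr_eq0 => [/allP h|i _]; last by rewrite -expr2 sqr_ge0.
apply/rowP => i; apply/eqP; have := h i; rewrite mem_index_enum => /(_ isT).
by rewrite mxE mulf_eq0 orbb.
Qed.

Lemma dot_gt0 n (x : 'rV[R]_n) : (0 < dot x x) = (x != 0).
Proof. by rewrite lt_neqAle dot_ge0 andbT eq_sym dot_eq0. Qed.

Lemma dot_deltal n (x : 'rV[R]_n) i : dot (delta_mx 0 i) x = x 0 i.
Proof.
rewrite /dot (bigD1 i) //= mxE !eqxx mul1r big1 ?addr0 // => j ji.
by rewrite mxE (negbTE ji) andbF mul0r.
Qed.

Lemma dot_mulmx n (x y : 'rV[R]_n) : dot x y = (x *m y^T) 0 0.
Proof. by rewrite mxE; apply: eq_bigr => i _; rewrite mxE. Qed.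

Lemma dot_row_mx n m (a c : 'rV[R]_n) (b d : 'rV[R]_m) :
  dot (row_mx a b) (row_mx c d) = dot a c + dot b d.
Proof.
rewrite /dot big_split_ord /=; congr (_ + _); apply: eq_bigr => i _.
  by rewrite !row_mxEl.
by rewrite !row_mxEr.
Qed.

Lemma cd_ind r (P : CD R r.+1 -> Prop) :
  (forall a b : CD R r, P (row_mx a b)) -> forall x, P x.
Proof. by move=> h x; rewrite -[x](@hsubmxK _ 1 (cd_dim r) (cd_dim r)). Qed.

Lemma cd_mulS r (a b c d : CD R r) :
  @cd_mul R r.+1 (row_mx a b) (row_mx c d) =
  row_mx (cd_mul a c - cd_mul (cd_conj d) b)
         (cd_mul d a + cd_mul b (cd_conj c)).
Proof. by rewrite /= !row_mxKl !row_mxKr. Qed.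

Lemma cd_conjS r (a b : CD R r) :
  @cd_conj R r.+1 (row_mx a b) = row_mx (cd_conj a) (- b).
Proof. by rewrite /= row_mxKl row_mxKr. Qed.

Lemma cd_reS r (a b : CD R r) : @cd_re R r.+1 (row_mx a b) = cd_re a.
Proof. by rewrite /= row_mxKl. Qed.

Lemma cd_conjD r (x y : CD R r) : cd_conj (x + y) = cd_conj x + cd_conj y.
Proof.
elim: r x y => [//|r IH] x y /=.
by rewrite -[lsubmx (x + y)]/(lsubmx _) !linearD /= IH add_row_mx.
Qed.

Lemma cd_conjZ r k (x : CD R r) : cd_conj (k *: x) = k *: cd_conj x.
Proof.
elim: r x => [//|r IH] x /=.
by rewrite !linearZ /= IH scale_row_mx scalerN.
Qed.

Lemma cd_reD r (x y : CD R r) : cd_re (x + y) = cd_re x + cd_re y.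
Proof. by elim: r x y => [|r IH] x y /=; rewrite ?mxE // linearD IH. Qed.

Lemma cd_reZ r k (x : CD R r) : cd_re (k *: x) = k * cd_re x.
Proof. by elim: r x => [|r IH] x /=; rewrite ?mxE // linearZ IH. Qed.

Lemma cd_reN r (x : CD R r) : cd_re (- x) = - cd_re x.
Proof. by rewrite -scaleN1r cd_reZ mulN1r. Qed.

Lemma cd_conjN r (x : CD R r) : cd_conj (- x) = - cd_conj x.
Proof. by rewrite -scaleN1r cd_conjZ scaleN1r. Qed.

Lemma cd_conj0 r : cd_conj (0 : CD R r) = 0.
Proof. by rewrite -(scale0r 0) cd_conjZ !scale0r. Qed.

(** All four laws go through one induction: the doubled product contains both [a c] and [d a], so
    linearity in one argument at level [r.+1] uses linearity in both at level [r]. *)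
Lemma cd_mul_linear r :
  (forall x y z : CD R r, cd_mul (x + y) z = cd_mul x z + cd_mul y z) *
  (forall x y z : CD R r, cd_mul z (x + y) = cd_mul z x + cd_mul z y) *
  (forall k (x z : CD R r), cd_mul (k *: x) z = k *: cd_mul x z) *
  (forall k (x z : CD R r), cd_mul z (k *: x) = k *: cd_mul z x).
Proof.
elim: r => [|r [[[IHl IHr] IHZl] IHZr]].
  do !split=> *; first exact: mulmxDl; first exact: mulmxDr.
    by rewrite /= scalemxAl.
  by rewrite /= scalemxAr.
have IHNl x z : cd_mul (- x) z = - cd_mul x z :> CD R r.
  by rewrite -scaleN1r IHZl scaleN1r.
do !split.
- move=> x y z; rewrite /= !linearD /= ?cd_conjD !(IHl, IHr) add_row_mx.
  by congr row_mx; apply/rowP => i; rewrite !mxE; ring.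
- move=> x y z; rewrite /= !linearD /= ?cd_conjD !(IHl, IHr) add_row_mx.
  by congr row_mx; apply/rowP => i; rewrite !mxE; ring.
- move=> k x z; rewrite /= !linearZ /= ?cd_conjZ !(IHZl, IHZr) scale_row_mx.
  by rewrite scalerBr scalerDr.
- move=> k x z; rewrite /= !linearZ /= ?cd_conjZ !(IHZl, IHZr) scale_row_mx.
  by rewrite scalerBr scalerDr.
Qed.

Lemma cd_mulDl r (x y z : CD R r) : cd_mul (x + y) z = cd_mul x z + cd_mul y z.
Proof. by rewrite cd_mul_linear. Qed.

Lemma cd_mulDr r (x y z : CD R r) : cd_mul z (x + y) = cd_mul z x + cd_mul z y.
Proof. by rewrite cd_mul_linear. Qed.

Lemma cd_mulZl r k (x z : CD R r) : cd_mul (k *: x) z = k *: cd_mul x z.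
Proof. by rewrite cd_mul_linear. Qed.

Lemma cd_mulZr r k (x z : CD R r) : cd_mul z (k *: x) = k *: cd_mul z x.
Proof. by rewrite cd_mul_linear. Qed.

Lemma cd_mulNl r (x z : CD R r) : cd_mul (- x) z = - cd_mul x z.
Proof. by rewrite -scaleN1r cd_mulZl scaleN1r. Qed.

Lemma cd_mulNr r (x z : CD R r) : cd_mul z (- x) = - cd_mul z x.
Proof. by rewrite -scaleN1r cd_mulZr scaleN1r. Qed.

Lemma cd_mul0l r (z : CD R r) : cd_mul 0 z = 0.
Proof. by rewrite -(scale0r 0) cd_mulZl !scale0r. Qed.

Lemma cd_mul0r r (z : CD R r) : cd_mul z 0 = 0.
Proof. by rewrite -(scale0r 0) cd_mulZr !scale0r. Qed.

Definition cd_lin := (cd_mulDl, cd_mulDr, cd_mulNl, cd_mulNr, cd_conjD,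
  cd_conjN, cd_reD, cd_reN).

Lemma cd_conjK r (x : CD R r) : cd_conj (cd_conj x) = x.
Proof.
elim: r x => [//|r IH]; apply: cd_ind => a b.
by rewrite !cd_conjS IH opprK.
Qed.

Lemma cd_conj1 r : cd_conj (cd_one R r) = cd_one R r.
Proof. by elim: r => [//|r IH]; rewrite cd_conjS IH oppr0. Qed.

Lemma cd_mul1 r (x : CD R r) :
  cd_mul x (cd_one R r) = x /\ cd_mul (cd_one R r) x = x.
Proof.
elim: r x => [|r IH] x; first by rewrite /= mulmx1 mul1mx.
move: x; apply: cd_ind => a b; rewrite !cd_mulS !cd_conj1.
by rewrite cd_conj0 !cd_mul0l !cd_mul0r !(IH _).1 (IH _).2 subr0 addr0 add0r.
Qed.

Lemma cd_conjM r (x y : CD R r) :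
  cd_conj (cd_mul x y) = cd_mul (cd_conj y) (cd_conj x).
Proof.
elim: r x y => [|r IH] x y.
  by apply/rowP => i; rewrite !ord1 /= !mxE !big_ord1 mulrC.
move: x y; apply: cd_ind => a b; apply: cd_ind => c d.
rewrite !(cd_mulS, cd_conjS) !cd_lin !IH !cd_conjK.
by congr row_mx; apply/rowP => i; rewrite !mxE; ring.
Qed.

Lemma cd_re_conj r (x : CD R r) : cd_re (cd_conj x) = cd_re x.
Proof. by elim: r x => [//|r IH]; apply: cd_ind => a b; rewrite cd_conjS !cd_reS. Qed.

Lemma cd_re1 r : cd_re (cd_one R r) = 1.
Proof. by elim: r => [|r IH]; rewrite ?cd_reS //= mxE eqxx. Qed.

Lemma cd_reC r (x y : CD R r) : cd_re (cd_mul x y) = cd_re (cd_mul y x).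
Proof.
elim: r x y => [|r IH] x y; first by rewrite /= !mxE !big_ord1 mulrC.
move: x y; apply: cd_ind => a b; apply: cd_ind => c d.
rewrite !cd_mulS !cd_reS !cd_lin IH; congr (_ - _).
by rewrite -cd_re_conj cd_conjM cd_conjK.
Qed.

(** Both sides expand to the same four real parts of triple products up to cyclic rotation, which
    the induction hypothesis and [cd_reC] allow. So brackets may be moved under [cd_re] at every
    level, associative or not. *)
Lemma cd_reA r (x y z : CD R r) :
  cd_re (cd_mul (cd_mul x y) z) = cd_re (cd_mul x (cd_mul y z)).
Proof.
elim: r x y z => [|r IH] x y z; first by rewrite /= mulmxA.
move: x y z; apply: cd_ind => a b; apply: cd_ind => c d; apply: cd_ind => e f.
rewrite !cd_mulS !cd_reS !cd_lin !cd_conjM !cd_conjK IH.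
have -> : cd_re (cd_mul (cd_mul (cd_conj d) b) e)
  = cd_re (cd_mul (cd_mul e (cd_conj d)) b) by rewrite [RHS]IH cd_reC.
have -> : cd_re (cd_mul (cd_conj f) (cd_mul d a))
  = cd_re (cd_mul a (cd_mul (cd_conj f) d)) by rewrite -[LHS]IH cd_reC.
have -> : cd_re (cd_mul (cd_conj f) (cd_mul b (cd_conj c)))
  = cd_re (cd_mul (cd_mul (cd_conj c) (cd_conj f)) b).
  by rewrite -[LHS]IH cd_reC [RHS]IH.
by ring.
Qed.

(** Turns conditions stated with [cd_re] and [cd_abs] into Euclidean geometry of rows, where the
    product no longer appears. *)
Lemma cd_re_dot r (x y : CD R r) : cd_re (cd_mul x (cd_conj y)) = dot x y.
Proof.
elim: r x y => [|r IH] x y; first by rewrite /dot big_ord1 /= mxE big_ord1.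
move: x y; apply: cd_ind => a b; apply: cd_ind => c d.
rewrite cd_conjS cd_mulS cd_reS dot_row_mx !cd_lin opprK IH.
by rewrite cd_reC IH.
Qed.

Lemma cd_absE r (x : CD R r) : cd_abs x = Num.sqrt (dot x x).
Proof. by rewrite /cd_abs cd_re_dot. Qed.

Lemma sqr_cd_abs r (x : CD R r) : cd_abs x ^+ 2 = dot x x.
Proof. by rewrite cd_absE sqr_sqrtr // dot_ge0. Qed.

(** Checked in coordinates after splitting down to the reals. It serves one level below the
    octonions, since the double of an associative algebra still satisfies the cancellation law
    [cd_mulKl]. *)
Lemma cd_mulA r : (r <= 2)%N -> associative (@cd_mul R r).
Proof.
case: r => [_|[_|[_|//]]].
- by move=> x y z; rewrite /= mulmxA.
- apply: cd_ind => a b; apply: cd_ind => c d; apply: cd_ind => e f.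
  rewrite !cd_mulS; congr row_mx; apply/rowP => i.
    by rewrite !ord1 /= !(mxE, big_ord1); ring.
  by rewrite !ord1 /= !(mxE, big_ord1); ring.
- apply: cd_ind => a b; apply: cd_ind => c d; apply: cd_ind => e f.
  move: a b c d e f; do 6!(apply: cd_ind => ? ?).
  rewrite !(cd_mulS, cd_conjS, opp_row_mx, add_row_mx, row_mxKl, row_mxKr).
  congr row_mx; congr row_mx; apply/rowP => i;
  by rewrite !ord1 /= !(mxE, big_ord1); ring.
Qed.

Lemma dot_conj r (x : CD R r) : dot (cd_conj x) (cd_conj x) = dot x x.
Proof. by rewrite -!cd_re_dot cd_conjK cd_reC. Qed.

(** At level [r], which is associative here, the cross terms cancel and [x~ x], [x x~] are scalars.
    [IHl], [IHr] and [IHr'] are the conjugate forms of the induction hypothesis. *)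
Lemma cd_mulKl r (x y : CD R r) : (r <= 3)%N ->
  cd_mul (cd_conj x) (cd_mul x y) = dot x x *: y.
Proof.
elim: r x y => [|r IH] x y.
  by move=> _; apply/rowP => i; rewrite /dot !ord1 /= !(mxE, big_ord1); ring.
move: x y; apply: cd_ind => a b; apply: cd_ind => c d hr.
have A := cd_mulA hr; have {}IH x y := IH x y (ltnW hr).
have IHl (x y : CD R r) : cd_mul x (cd_mul (cd_conj x) y) = dot x x *: y.
  by rewrite -(dot_conj x) -IH cd_conjK.
have IHr (x y : CD R r) : cd_mul (cd_mul x (cd_conj y)) y = dot y y *: x.
  rewrite -[LHS]cd_conjK cd_conjM [cd_conj (cd_mul x _)]cd_conjM cd_conjK IH.
  by rewrite cd_conjZ cd_conjK.
have IHr' (x y : CD R r) : cd_mul (cd_mul x y) (cd_conj y) = dot y y *: x.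
  by rewrite -(dot_conj y) -IHr cd_conjK.
rewrite cd_conjS !cd_mulS !cd_lin !cd_conjM !cd_conjK dot_row_mx.
rewrite IH IHl IHr IHr' -!A scale_row_mx.
by congr row_mx; apply/rowP => i; rewrite !mxE; ring.
Qed.

Lemma cd_mulKr r (x y : CD R r) : (r <= 3)%N ->
  cd_mul (cd_mul y (cd_conj x)) x = dot x x *: y.
Proof.
move=> hr; rewrite -[LHS]cd_conjK cd_conjM [cd_conj (cd_mul y _)]cd_conjM.
by rewrite cd_conjK cd_mulKl // cd_conjZ cd_conjK.
Qed.

(** [Re((y~ x~) (x y))] is rebracketed by [cd_reA] into [Re(y~ (x~ (x y)))], from which [cd_mulKl]
    extracts [|x|^2]. *)
Lemma dot_mul r (x y : CD R r) : (r <= 3)%N ->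
  dot (cd_mul x y) (cd_mul x y) = dot x x * dot y y.
Proof.
move=> hr; rewrite -cd_re_dot cd_reC cd_conjM cd_reA cd_mulKl // cd_mulZr.
by rewrite cd_reZ cd_reC cd_re_dot.
Qed.

Lemma cd_abs_ge0 r (x : CD R r) : 0 <= cd_abs x.
Proof. exact: sqrtr_ge0. Qed.

Lemma cd_absM r (x y : CD R r) : (r <= 3)%N ->
  cd_abs (cd_mul x y) = cd_abs x * cd_abs y.
Proof. by move=> hr; rewrite !cd_absE dot_mul // sqrtrM // dot_ge0. Qed.

Lemma dot_one r : dot (cd_one R r) (cd_one R r) = 1.
Proof. by rewrite -cd_re_dot cd_conj1 (cd_mul1 _).1 cd_re1. Qed.

Lemma cd_abs1 r : cd_abs (cd_one R r) = 1.
Proof. by rewrite cd_absE dot_one sqrtr1. Qed.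

Lemma cd_abs_conj r (x : CD R r) : cd_abs (cd_conj x) = cd_abs x.
Proof. by rewrite !cd_absE dot_conj. Qed.

Lemma cd_absZ r k (x : CD R r) : cd_abs (k *: x) = `|k| * cd_abs x.
Proof.
by rewrite !cd_absE dotZl dotZr mulrA -expr2 sqrtrM ?sqr_ge0 // sqrtr_sqr.
Qed.

Lemma cd_abs0 r : cd_abs (0 : CD R r) = 0.
Proof. by rewrite cd_absE dot0l sqrtr0. Qed.

Lemma cd_absN r (x : CD R r) : cd_abs (- x) = cd_abs x.
Proof. by rewrite -scaleN1r cd_absZ normrN1 mul1r. Qed.

Lemma cd_abs_eq0 r (x : CD R r) : (cd_abs x == 0) = (x == 0).
Proof. by rewrite cd_absE sqrtr_eq0 le_eqVlt ltNge dot_ge0 orbF dot_eq0. Qed.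

Lemma cd_abs_gt0 r (x : CD R r) : (0 < cd_abs x) = (x != 0).
Proof. by rewrite lt_def cd_abs_ge0 andbT cd_abs_eq0. Qed.

Lemma cauchy_schwarz n (x y : 'rV[R]_n) : dot x y ^+ 2 <= dot x x * dot y y.
Proof.
have [->|y0] := eqVneq y 0; first by rewrite dotC !dot0l expr0n mulr0.
have yy : 0 < dot y y by rewrite dot_gt0.
have := dot_ge0 (dot y y *: x - dot x y *: y).
rewrite !(dotDl, dotDr, dotNl, dotNr, dotZl, dotZr) (dotC y x) => h.
rewrite -(ler_pM2l yy) -subr_ge0; apply: le_trans h _.
by rewrite le_eqVlt; apply/orP; left; apply/eqP; ring.
Qed.

Lemma cd_absD r (x y : CD R r) : cd_abs (x + y) <= cd_abs x + cd_abs y.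
Proof.
rewrite -(ler_pXn2r (n := 2)) ?nnegrE ?addr_ge0 ?cd_abs_ge0 //.
rewrite sqrrD !sqr_cd_abs dotDl !dotDr (dotC y x).
suff : dot x y <= cd_abs x * cd_abs y by rewrite mulr2n; lra.
apply: le_trans (ler_norm _) _.
rewrite -(ler_pXn2r (n := 2)) ?nnegrE ?mulr_ge0 ?cd_abs_ge0 //.
by rewrite exprMn !sqr_cd_abs real_normK ?num_real // cauchy_schwarz.
Qed.

Lemma cd_abs_sum r (I : Type) (s : seq I) (F : I -> CD R r) :
  cd_abs (\sum_(i <- s) F i) <= \sum_(i <- s) cd_abs (F i).
Proof.
elim/big_rec2: _ => [|i y x _ h]; first by rewrite cd_abs0.
by apply: le_trans (cd_absD _ _) _; apply: lerD.
Qed.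

Lemma le_coord_cd_abs r (x : CD R r) i : `|x 0 i| <= cd_abs x.
Proof.
rewrite -(ler_pXn2r (n := 2)) ?nnegrE ?cd_abs_ge0 // sqr_cd_abs.
rewrite real_normK ?num_real // /dot (bigD1 i) //= -expr2 lerDl.
by apply: sumr_ge0 => j _; rewrite -expr2 sqr_ge0.
Qed.

Lemma le_coord_norm n (x : 'rV[R]_n) i : `|x 0 i| <= `|x|.
Proof.
rewrite -[`|x|]/(mx_norm x) mx_normrE.
exact: (le_bigmax _ (fun ij : 'I_1 * 'I_n => `|x ij.1 ij.2|) (0, i)).
Qed.

Lemma norm_le_coord n (x : 'rV[R]_n) c :
  0 <= c -> (forall i, `|x 0 i| <= c) -> `|x| <= c.
Proof.
move=> c0 h; rewrite -[`|x|]/(mx_norm x) mx_normrE; apply/bigmax_leP.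
by split => // -[i j] _; rewrite ord1.
Qed.

Lemma le_norm_cd_abs r (x : CD R r) : `|x| <= cd_abs x.
Proof. by apply: norm_le_coord => [|i]; rewrite ?cd_abs_ge0 ?le_coord_cd_abs. Qed.

Lemma le_cd_abs_norm r (x : CD R r) : cd_abs x <= (cd_dim r)%:R * `|x|.
Proof.
rewrite {1}[x]row_sum_delta; apply: (le_trans (cd_abs_sum _ _)).
rewrite mulr_natl -[X in _ *+ X]card_ord -sumr_const; apply: ler_sum => i _.
by rewrite cd_absZ cd_absE dot_deltal mxE !eqxx sqrtr1 mulr1 le_coord_norm.
Qed.

Lemma sum_row_mx n m (I : Type) (s : seq I) (F : I -> 'rV[R]_n)
    (G : I -> 'rV[R]_m) :
  \sum_(i <- s) row_mx (F i) (G i) =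
  row_mx (\sum_(i <- s) F i) (\sum_(i <- s) G i).
Proof.
elim/big_rec3: _ => [|i y x z _ ->]; last by rewrite add_row_mx.
by apply/rowP => j; rewrite !mxE; case: (fintype.split j) => k; rewrite mxE.
Qed.

Lemma cd_mul_diag_l r (a b e : CD R r) : (r <= 3)%N ->
  @cd_mul R r.+1 (row_mx e 0) (@cd_mul R r.+1 (row_mx a b) (row_mx e 0)) =
  row_mx (cd_mul e (cd_mul a e)) (dot e e *: b).
Proof.
move=> hr; rewrite [X in cd_mul _ X]cd_mulS cd_mulS.
rewrite !(cd_mul0l, cd_mul0r, cd_conj0, addr0, subr0, add0r, sub0r).
by rewrite cd_mulKr.
Qed.

Lemma cd_mul_diag_r r (a b e : CD R r) : (r <= 3)%N ->
  @cd_mul R r.+1 (row_mx 0 e) (@cd_mul R r.+1 (row_mx a b) (row_mx 0 e)) =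
  row_mx (- (dot e e *: cd_conj a)) (- cd_mul e (cd_mul (cd_conj b) e)).
Proof.
move=> hr; rewrite [X in cd_mul _ X]cd_mulS cd_mulS.
rewrite !(cd_mul0l, cd_mul0r, cd_conj0, addr0, subr0, add0r, sub0r).
by rewrite !cd_conjM !cd_conjN !cd_conjM cd_conjK cd_mulNr cd_mulKr.
Qed.

(** For quaternions this is [x + i x i + j x j + k x k = - 2 x~]. The induction splits the basis
    into vectors [(e, 0)] and [(0, e)]; with [N] the dimension at level [r], they contribute
    [(2 - N) a~ - N a~] and [N b - (2 - N) b]. The factor vanishes for complex numbers, where
    conjugation is indeed no sum of words in [z]. *)
Lemma sum_basis_conj r (h : CD R r) : (r <= 3)%N ->
  \sum_i cd_mul (delta_mx 0 i) (cd_mul h (delta_mx 0 i)) =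
  (2 - (cd_dim r)%:R) *: cd_conj h.
Proof.
elim: r h => [|r IH] h hr.
  rewrite big_ord1; apply/rowP => i; have {i}-> : i = 0 by exact: ord1.
  by rewrite /= !(mxE, big_ord1) eqxx /=; ring.
move: h; apply: cd_ind => a b.
have {}IH x := IH x (ltnW hr); have {}hr := ltnW hr.
have e1 i : dot (delta_mx 0 i : CD R r) (delta_mx 0 i) = 1.
  by rewrite dot_deltal mxE !eqxx.
have -> : \sum_i @cd_mul R r.+1 (delta_mx 0 i)
      (@cd_mul R r.+1 (row_mx a b) (delta_mx 0 i)) =
    \sum_i row_mx (cd_mul (delta_mx 0 i) (cd_mul a (delta_mx 0 i))) b +
    \sum_i row_mx (- cd_conj a)
      (- cd_mul (delta_mx 0 i) (cd_mul (cd_conj b) (delta_mx 0 i))).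
  etransitivity; first exact: big_split_ord.
  congr (_ + _); apply: eq_bigr => i _.
    by rewrite delta_mx_lshift cd_mul_diag_l // e1 scale1r.
  by rewrite delta_mx_rshift cd_mul_diag_r // e1 scale1r.
rewrite !sum_row_mx !sumrN !IH cd_conjK !sumr_const card_ord add_row_mx.
rewrite cd_conjS scale_row_mx -(scaler_nat _ b) -(scaler_nat _ (cd_conj a)).
rewrite [(cd_dim r.+1)%:R]natrD.
by congr row_mx; apply/rowP => i; rewrite !mxE; ring.
Qed.

Lemma cd_sum_mulr r (I : Type) (s : seq I) (F : I -> CD R r) y :
  cd_mul y (\sum_(i <- s) F i) = \sum_(i <- s) cd_mul y (F i).
Proof.
by elim/big_rec2: _ => [|i z x _ <-]; rewrite ?cd_mul0r // cd_mulDr.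
Qed.

(* Conjugation is itself a sum of words [e (y e)], so that
   [Re y = (y + y~) / 2], and with it every coordinate [Re (e~ h)] of [h], is a
   sum of words in [h]. *)
Lemma linear_words r (A : 'M[R]_(cd_dim r)) : (2 <= r <= 3)%N ->
  exists K (c1 c2 c3 c4 : 'I_K -> CD R r), forall h,
    h *m A = \sum_k cd_mul (c1 k) (cd_mul (c2 k)
                (cd_mul (cd_mul (c3 k) h) (c4 k))).
Proof.
move=> /andP[r2 r3].
(* The index [(i, o)] stands for the [i]-th coordinate and a summand of [Re y = (y + y~) / 2]:
   [None] is the word [1 (y 1)], [Some j] the word [e_j (y e_j)]. *)
pose n := cd_dim r; pose T := ('I_n * option 'I_n)%type.
have n2 : 2 - n%:R != 0 :> R.
  by rewrite subr_eq0 eqr_nat /n; move: r2 r3; case: (r) => [|[|[|[|]]]].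
pose e (o : option 'I_n) : CD R r := if o is Some i then delta_mx 0 i
  else cd_one R r.
(* The weight is [1/2] for [y] itself, and [1/2] divided by the factor [2 - n] of [sum_basis_conj]
   for each word that makes up [y~]. *)
pose k (o : option 'I_n) : R := if o is Some i then (2 - n%:R)^-1 / 2 else 2^-1.
exists #|{: T}|.
exists (fun t => k (enum_val t).2 *: row (enum_val t).1 A).
exists (fun t => e (enum_val t).2).
exists (fun t => cd_conj (delta_mx 0 (enum_val t).1)).
exists (fun t => e (enum_val t).2).
move=> h.
transitivity (\sum_(t : T) cd_mul (k t.2 *: row t.1 A) (cd_mul (e t.2)
    (cd_mul (cd_mul (cd_conj (delta_mx 0 t.1)) h) (e t.2)))); last first.
  by rewrite (reindex (fun j : 'I_#|{: T}| => enum_val j)) //=; apply: onW_bij; exact: enum_val_bij.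
rewrite -(pair_bigA _ (fun (i : 'I_n) o => cd_mul (k o *: row i A) (cd_mul (e o)
    (cd_mul (cd_mul (cd_conj (delta_mx 0 i)) h) (e o))))) /=.
rewrite mulmx_sum_row; apply: eq_bigr => i _.
set y := cd_mul _ h.
under eq_bigr do rewrite cd_mulZl -cd_mulZr.
rewrite -cd_sum_mulr.
have -> : \sum_o k o *: cd_mul (e o) (cd_mul y (e o)) = h 0 i *: cd_one R r.
  rewrite (bigD1 None) //= (cd_mul1 _).1 (cd_mul1 _).2.
  have -> : \sum_(o | o != None) k o *: cd_mul (e o) (cd_mul y (e o)) =
      2^-1 *: cd_conj y.
    rewrite (reindex_omap Some id) /=; last by case.
    rewrite (eq_bigl predT) => [|j]; last by rewrite eqxx.
    rewrite -scaler_sumr sum_basis_conj // scalerA; congr (_ *: _).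
    by rewrite -/n; field.
  rewrite -scalerDr cd_reE scalerA mulrA mulVf ?pnatr_eq0 // mul1r.
  by rewrite /y cd_reC cd_re_dot dotC dot_deltal.
by rewrite cd_mulZr (cd_mul1 _).1.
Qed.

End CayleyDickson.

(** * Smooth functions *)

Section Calculus.
Variables (R : realType) (V : normedModType R).
Implicit Types (u v : V -> R) (x h k : V) (U : set V).

Lemma diff_rZ u x (a : R) h : 'd u x (a *: h) = a * 'd u x h.
Proof. exact: linearZ. Qed.

Lemma diff_rD u x h k : 'd u x (h + k) = 'd u x h + 'd u x k.
Proof. exact: linearD. Qed.

Lemma diff_rN u x h : 'd u x (- h) = - 'd u x h.
Proof. exact: linearN. Qed.

Lemma diff_le_near u x : differentiable u x -> forall e, 0 < e ->
  \forall h \near (0 : V), `|u (x + h) - u x - 'd u x h| <= e * `|h|.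
Proof.
move=> /diff_locally /eqaddoP H e e0; have := H e e0.
apply: filterS => h /=; rewrite /cst !fctE /= [h + x]addrC.
by rewrite opprD addrA.
Qed.

Lemma near_le_diff u (df : {linear V -> R}) x : continuous df ->
  (forall e, 0 < e ->
    \forall h \near (0 : V), `|u (x + h) - u x - df h| <= e * `|h|) ->
  differentiable u x /\ 'd u x = df :> (V -> R).
Proof.
move=> dfc H.
have E : u \o shift x = cst (u x) + df +o_ (0 : V) id.
  apply/eqaddoP => e e0; apply: filterS (H e e0) => h /=.
  by rewrite /cst !fctE /= [h + x]addrC opprD addrA.
have D := diff_unique dfc E.
split=> //; apply/diff_locallyP; rewrite D; split => //.
Qed.

Lemma near_eq_diff u v x : (\forall y \near x, u y = v y) ->
  differentiable u x -> differentiable v x /\ 'd v x = 'd u x :> (V -> R).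
Proof.
move=> uv du.
have vx : v x = u x by rewrite (nbhs_singleton uv).
have [|//|? ?] := @near_le_diff v ('d u x) x; last by [].
  exact: diff_continuous.
move=> e e0; have H := diff_le_near du e0.
have uv' : \forall h \near (0 : V), u (x + h) = v (x + h).
  have : (fun h => x + h) @ (0 : V) --> x.
    by rewrite -[X in _ --> X]addr0; apply: cvgD; [exact: cvg_cst|exact: cvg_id].
  by move=> /(_ _ uv).
by apply: filterS2 H uv' => h; rewrite vx => ? <-.
Qed.

Lemma line_derive u x h (t : R) : differentiable u (x + t *: h) ->
  is_derive t 1 (fun s : R => u (x + s *: h)) ('d u (x + t *: h) h).
Proof.
move=> du.
have E : (fun s : R => s^-1 *: (((fun s : R => u (x + s *: h)) \o shift t) (s *: 1)
    - u (x + t *: h))) =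
    (fun s : R => s^-1 *: ((u \o shift (x + t *: h)) (s *: h) - u (x + t *: h))).
  rewrite funeqE => s; congr (_ *: (u _ - _)).
  by rewrite /= scalerDl addrCA [_ *: 1]mulr1.
split.
  by rewrite /derivable E; exact: diff_derivable.
by rewrite /derive E -/(derive u _ _) deriveE.
Qed.

Lemma mvt_line u x h :
  (forall t : R, 0 <= t <= 1 -> differentiable u (x + t *: h)) ->
  exists2 t : R, 0 < t < 1 & u (x + h) - u x = 'd u (x + t *: h) h.
Proof.
move=> du; pose f (s : R) := u (x + s *: h).
have [|||t t01] := @MVT R f (fun t => 'd u (x + t *: h) h) 0 1; first by [].
- move=> t; rewrite in_itv /= => /andP[t0 t1]; apply: line_derive; apply: du.
  by rewrite !ltW.
- apply: derivable_within_continuous => t; rewrite in_itv /= => t01.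
  by have [] := line_derive (du t t01).
rewrite /f scale1r scale0r addr0 subr0 mulr1 => e; by exists t.
Qed.

Lemma segment_ball x y e (t : R) : 0 <= t <= 1 -> `|y - x| < e ->
  ball x e (x + t *: (y - x)).
Proof.
move=> /andP[t0 t1] xy; rewrite -ball_normE /= opprD addNKr normrN normrZ.
by rewrite (le_lt_trans _ xy) // ger0_norm // ler_piMl.
Qed.

Lemma locally_constant_connected (T : Type) (U : set V) (f : V -> T) :
  open U -> connected U ->
  (forall x, U x -> \forall y \near x, f y = f x) ->
  forall x y, U x -> U y -> f x = f y.
Proof.
move=> oU cU lc x y Ux Uy.
have ofib (P : set T) : open (U `&` f @^-1` P).
  rewrite openE => z [Uz Pz]; have Uz' := open_nbhs_nbhs (conj oU Uz).
  apply: filterS2 (lc z Uz) Uz' => w e Uw; split => //.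
  by rewrite -[_ w]/(P (f w)) e.
have E : U `&` f @^-1` [set f x] = U.
  apply: cU; first by exists x.
    by exists (U `&` f @^-1` [set f x]); rewrite // setIA setIid.
  exists (~` (U `&` f @^-1` (~` [set f x]))); first exact/open_closedC.
  apply/seteqP; split => z /=; first by move=> [Uz e]; split => // -[_]; apply.
  by move=> [Uz e]; split => //; apply: contrapT => ne; apply: e.
by move: Uy; rewrite -E => -[].
Qed.

Lemma diff0_constant U u : open U -> connected U ->
  (forall x, U x -> differentiable u x) -> (forall x h, U x -> 'd u x h = 0) ->
  forall x y, U x -> U y -> u x = u y.
Proof.
move=> oU cU du u0; apply: locally_constant_connected => // x Ux.
have /nbhs_ballP[e /= e0 xe] := open_nbhs_nbhs (conj oU Ux).
near=> y.
have yx : `|y - x| < e.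
  have : ball x e y by near: y; exact: nbhsx_ballx.
  by rewrite -ball_normE /= distrC.
have seg t : 0 <= t <= 1 -> U (x + t *: (y - x)).
  by move=> t01; apply: xe; exact: segment_ball.
have [t t01|t t01] := @mvt_line u x (y - x); first exact/du/seg.
rewrite u0; last by apply: seg; case/andP: t01 => *; rewrite !ltW.
by rewrite [x + _]addrC subrK => /subr0_eq.
Unshelve. all: by end_near. Qed.

Let second_difference u x h k (t : R) := u (x + t *: h + t *: k) -
  u (x + t *: h) - u (x + t *: k) + u x.

(** The mean value theorem, applied once in the direction [h] to the difference of [u] along two
    opposite sides of the parallelogram, leaves a difference of two values of ['d u _ h]. These are
    then linearised at [x], so differentiability of ['d u _ h] at that single point suffices. *)
Lemma second_difference_le u x h k :
  (\forall y \near x, differentiable u y) ->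
  differentiable (fun y => 'd u y h) x -> forall e, 0 < e ->
  \forall t \near (0 : R)^'+,
    `|second_difference u x h k t - t ^+ 2 * 'd (fun y => 'd u y h) x k|
    <= e * t ^+ 2.
Proof.
move=> du dh e e0.
(* Every point used is [x + a t h + b t k] with [a], [b] in [[0, 1]], at distance at most [t M] from
   [x]; the [1] keeps [M] positive. *)
pose M := `|h| + `|k| + 1.
have M0 : 0 < M by rewrite ltr_wpDl // addr_ge0.
have d0 : 0 < e / (2 * M) by rewrite divr_gt0 // mulr_gt0.
have /nbhs_ballP[r1 /= r10 H1] := diff_le_near dh d0.
have /nbhs_ballP[r2 /= r20 H2] := du.
near=> t.
have t0 : 0 < t by near: t; exact: nbhs_right_gt.
have tr1 : t * M < r1.
  rewrite -ltr_pdivlMr //; near: t; apply: nbhs_right_lt; exact: divr_gt0.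
have tr2 : t * M < r2.
  rewrite -ltr_pdivlMr //; near: t; apply: nbhs_right_lt; exact: divr_gt0.
have small (a b : R) : 0 <= a <= 1 -> 0 <= b <= 1 ->
    `|a *: (t *: h) + b *: (t *: k)| <= t * M.
  move=> /andP[a0 a1] /andP[b0 b1]; apply: le_trans (ler_normD _ _) _.
  rewrite !normrZ !(ger0_norm a0, ger0_norm b0, gtr0_norm t0).
  have : a * (t * `|h|) <= t * `|h| by rewrite ler_piMl // mulr_ge0 // ltW.
  have : b * (t * `|k|) <= t * `|k| by rewrite ler_piMl // mulr_ge0 // ltW.
  by rewrite /M !mulrDr; lra.
have inb (r : R) z : `|z| <= t * M -> t * M < r -> ball x r (x + z).
  by move=> h1 h2; rewrite -ball_normE /= opprD addNKr normrN (le_lt_trans h1).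
have inb0 (r : R) z : `|z| <= t * M -> t * M < r -> ball (0 : V) r z.
  by move=> h1 h2; rewrite -ball_normE /= sub0r normrN (le_lt_trans h1).
have i01 : 0 <= (1 : R) <= 1 by rewrite ler01 lexx.
have i00 : 0 <= (0 : R) <= 1 by rewrite ler01 lexx.
pose f (s : R) := u (x + t *: k + s *: (t *: h)) - u (x + s *: (t *: h)).
have f' (s : R) : 0 <= s <= 1 -> is_derive s 1 f
    ('d u (x + t *: k + s *: (t *: h)) (t *: h) -
     'd u (x + s *: (t *: h)) (t *: h)).
  move=> s01; apply: is_deriveB; apply: line_derive; apply: H2.
    rewrite -addrA -[t *: k]scale1r [_ + s *: _]addrC.
    by apply: inb tr2; exact: small.
  rewrite -[s *: _]addr0 -[0](scale0r (t *: k)).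
  by apply: inb tr2; exact: small.
have [|||s] := @MVT R f (fun s => 'd u (x + t *: k + s *: (t *: h)) (t *: h) -
     'd u (x + s *: (t *: h)) (t *: h)) 0 1; first by [].
- by move=> s; rewrite in_itv /= => /andP[s0 s1]; apply: f'; rewrite !ltW.
- apply: derivable_within_continuous => s; rewrite in_itv /= => s01.
  by have [] := f' s s01.
rewrite in_itv /= => /andP[/ltW s0 /ltW s1].
rewrite /f scale1r scale0r !addr0 subr0 mulr1 !diff_rZ => fE.
have -> : second_difference u x h k t = t * ('d u (x + t *: k + s *: (t *: h)) h -
     'd u (x + s *: (t *: h)) h).
  rewrite mulrBr; etransitivity; last exact: fE.
  by rewrite /second_difference [x + t *: k + _]addrAC opprB addrA addrAC.
have s01 : 0 <= s <= 1 by rewrite s0.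
pose z1 := s *: (t *: h) + t *: k; pose z2 := s *: (t *: h).
have z1M : `|z1| <= t * M by rewrite /z1 -[t *: k]scale1r; exact: small.
have z2M : `|z2| <= t * M.
  by rewrite /z2 -[s *: _]addr0 -[0](scale0r (t *: k)); exact: small.
have b1 := H1 _ (inb0 _ _ z1M tr1); have b2 := H1 _ (inb0 _ _ z2M tr1).
rewrite -addrA [t *: k + _]addrC -/z1 -/z2.
set L := 'd (fun y => 'd u y h) x in b1 b2 *.
have eM : e / 2 * t = e / (2 * M) * (t * M).
  by field; rewrite gt_eqF.
have {b1} b1 : `|'d u (x + z1) h - 'd u x h - L z1| <= e / 2 * t.
  by apply: (le_trans b1); rewrite eM ler_pM2l.
have {b2} b2 : `|'d u (x + z2) h - 'd u x h - L z2| <= e / 2 * t.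
  by apply: (le_trans b2); rewrite eM ler_pM2l.
have Lz : L z1 - L z2 = t * L k.
  by rewrite -linearB /z1 /z2 addrAC subrr add0r linearZ.
have -> : t * ('d u (x + z1) h - 'd u (x + z2) h) - t ^+ 2 * L k =
   t * (('d u (x + z1) h - 'd u x h - L z1) -
        ('d u (x + z2) h - 'd u x h - L z2)).
  by rewrite expr2 -mulrA -Lz; ring.
rewrite normrM gtr0_norm // expr2 mulrCA ler_pM2l //.
apply: le_trans (ler_normB _ _) _.
by rewrite [leRHS](_ : _ = e / 2 * t + e / 2 * t) ?lerD // -mulrDl -splitr.
Unshelve. all: by end_near. Qed.

(** The second difference is symmetric in [h] and [k], so [t^2] times either mixed derivative
    approximates the same number up to a small multiple of [t^2]. *)
Lemma schwarz u x h k :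
  (\forall y \near x, differentiable u y) ->
  differentiable (fun y => 'd u y h) x ->
  differentiable (fun y => 'd u y k) x ->
  'd (fun y => 'd u y h) x k = 'd (fun y => 'd u y k) x h.
Proof.
move=> du dh dk.
apply/eqP; rewrite -subr_eq0 -normr_le0; apply/ler_addgt0Pl => e e0; rewrite addr0.
have e20 : 0 < e / 2 by rewrite divr_gt0.
near (0 : R)^'+ => t.
have t0 : 0 < t by near: t; exact: nbhs_right_gt.
have b1 : `|second_difference u x h k t - t ^+ 2 * 'd (fun y => 'd u y h) x k| <= e / 2 * t ^+ 2.
  by near: t; exact: second_difference_le.
have b2 : `|second_difference u x k h t - t ^+ 2 * 'd (fun y => 'd u y k) x h| <= e / 2 * t ^+ 2.
  by near: t; exact: second_difference_le.
have DC : second_difference u x k h t = second_difference u x h k t.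
  by rewrite /second_difference [x + t *: k + _]addrAC [_ - u (x + t *: k) - _]addrAC.
rewrite DC in b2.
rewrite -(@ler_pM2r _ (t ^+ 2)) ?exprn_gt0 //.
rewrite -{1}[t ^+ 2]gtr0_norm ?exprn_gt0 // -normrM.
move: b1 b2; set a := 'd _ x k; set b := 'd _ x h => b1 b2.
have -> : (a - b) * t ^+ 2 =
  (second_difference u x h k t - t ^+ 2 * b) - (second_difference u x h k t - t ^+ 2 * a) by ring.
apply: le_trans (ler_normB _ _) _.
by rewrite [leRHS](_ : _ = e / 2 * t ^+ 2 + e / 2 * t ^+ 2) ?lerD // -mulrDl -splitr.
Unshelve. all: by end_near. Qed.

End Calculus.

HB.lock Definition pd (R : realType) (V : normedModType R) (h : V) (u : V -> R)
  : V -> R := fun x => 'd u x h.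

Section SmoothFunctions.
Variables (R : realType) (V : normedModType R).
Implicit Types (u v : V -> R) (x h k : V) (U : set V).

Lemma pdE u x h : pd h u x = 'd u x h.
Proof. by rewrite pd.unlock. Qed.

Lemma pdZr u x (a : R) h : pd (a *: h) u x = a * pd h u x.
Proof. by rewrite !pdE diff_rZ. Qed.

Lemma pdDr u x h k : pd (h + k) u x = pd h u x + pd k u x.
Proof. by rewrite !pdE diff_rD. Qed.

Lemma pdNr u x h : pd (- h) u x = - pd h u x.
Proof. by rewrite !pdE diff_rN. Qed.

Lemma pd0r u x : pd 0 u x = 0.
Proof. by rewrite -(scale0r 0) pdZr mul0r. Qed.

Lemma pd_sumr (I : Type) (s : seq I) (a : I -> R) (e : I -> V) u x :
  pd (\sum_(i <- s) a i *: e i) u x = \sum_(i <- s) a i * pd (e i) u x.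
Proof.
by elim/big_rec2: _ => [|i y z _ <-]; rewrite ?pd0r // pdDr pdZr.
Qed.

(** Formulated through all directional derivatives so that it can be iterated on scalar functions.
    Continuity of the last derivatives is not part of it, and order [0] is no condition at all. *)
Fixpoint smooth (n : nat) (U : set V) (u : V -> R) {struct n} : Prop :=
  match n with
  | 0%N => True
  | n'.+1 => (forall x, U x -> differentiable u x) /\
             (forall h, smooth n' U (pd h u))
  end.

Lemma smooth_le n U u : smooth n.+1 U u -> smooth n U u.
Proof.
elim: n u => [//|n IH] u [du su]; split => // h; exact/IH/su.
Qed.

Lemma smooth_pd n U u h : smooth n.+1 U u -> smooth n U (pd h u).
Proof. by move=> [_ su]; exact: su. Qed.

Lemma smooth_diff n U u x : smooth n.+1 U u -> U x -> differentiable u x.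
Proof. by move=> [du _]; exact: du. Qed.

Lemma pd_near_eq u v x h : (\forall y \near x, u y = v y) ->
  differentiable u x -> pd h v x = pd h u x.
Proof.
by move=> uv du; rewrite !pdE; have [_ ->] := near_eq_diff uv du.
Qed.

Lemma pd_eq U u v x h : open U -> (forall x, U x -> u x = v x) ->
  U x -> differentiable u x -> pd h v x = pd h u x.
Proof.
move=> oU uv Ux; apply: pd_near_eq.
by apply: filterS (open_nbhs_nbhs (conj oU Ux)) => y /uv.
Qed.

Lemma smooth_ext n U u v : open U -> (forall x, U x -> u x = v x) ->
  smooth n U u -> smooth n U v.
Proof.
move=> oU; elim: n u v => [//|n IH] u v uv [du su].
split=> [x Ux|h].
  have uvn : \forall y \near x, u y = v y.
    by apply: filterS (open_nbhs_nbhs (conj oU Ux)) => y /uv.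
  by have [] := near_eq_diff uvn (du x Ux).
by apply: IH (su h) => x Ux; rewrite (pd_eq h oU uv Ux (du x Ux)).
Qed.

Lemma smooth_local n U u :
  (forall x, U x -> exists2 W, open W /\ W x & smooth n W u) -> smooth n U u.
Proof.
elim: n u => [//|n IH] u lu; split=> [x Ux|h].
  by have [W [_ Wx] [dW _]] := lu x Ux; exact: dW.
by apply: IH => x Ux; have [W oW [_ sW]] := lu x Ux; exists W => //; exact: sW.
Qed.

Lemma smooth_subset n U W u : W `<=` U -> smooth n U u -> smooth n W u.
Proof.
move=> WU; elim: n u => [//|n IH] u [du su]; split=> [x /WU/du //|h].
exact/IH/su.
Qed.

Lemma pd_cst a x h : pd h (fun=> a) x = 0.
Proof. by rewrite pdE (diff_cst a). Qed.

Lemma pdD u v x h : differentiable u x -> differentiable v x ->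
  pd h (fun y => u y + v y) x = pd h u x + pd h v x.
Proof.
by move=> du dv; rewrite !pdE -[fun y => _]/(u + v) diffD.
Qed.

Lemma pdM u v x h : differentiable u x -> differentiable v x ->
  pd h (fun y => u y * v y) x = u x * pd h v x + v x * pd h u x.
Proof.
by move=> du dv; rewrite !pdE -[fun y => _]/(u * v) diffM.
Qed.

Lemma diffDf u v x : differentiable u x -> differentiable v x ->
  differentiable (fun y => u y + v y) x.
Proof. by move=> du dv; apply: differentiableD. Qed.

Lemma diffMf u v x : differentiable u x -> differentiable v x ->
  differentiable (fun y => u y * v y) x.
Proof. by move=> du dv; apply: differentiableM. Qed.

Lemma diffZf (c : R) u x : differentiable u x ->
  differentiable (fun y => c * u y) x.
Proof.
by move=> du; apply: diffMf => //; exact: (@differentiable_cst R V R^o).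
Qed.

Lemma pdZ (c : R) u x h : differentiable u x ->
  pd h (fun y => c * u y) x = c * pd h u x.
Proof.
have dc : differentiable (fun=> c : R) x by exact: (@differentiable_cst R V R^o).
by move=> du; rewrite (pdM h dc du) pd_cst mulr0 addr0.
Qed.

Lemma smooth_cst n U a : smooth n U (fun=> a).
Proof.
elim: n a => [//|n IH] a; split=> [x _|h]; first exact: differentiable_cst.
by rewrite [X in smooth _ _ X](_ : _ = fun=> 0) //; apply/funext => x; rewrite pd_cst.
Qed.

Lemma smoothD n U u v : open U -> smooth n U u -> smooth n U v ->
  smooth n U (fun x => u x + v x).
Proof.
move=> oU; elim: n u v => [//|n IH] u v [du su] [dv sv].
split=> [x Ux|h]; first by apply: differentiableD; [exact: du|exact: dv].
apply: smooth_ext (IH _ _ (su h) (sv h)) => // x Ux.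
by rewrite pdD //; [exact: du|exact: dv].
Qed.

Lemma smoothM n U u v : open U -> smooth n U u -> smooth n U v ->
  smooth n U (fun x => u x * v x).
Proof.
move=> oU; elim: n u v => [//|n IH] u v su sv.
have [du su'] := su; have [dv sv'] := sv.
split=> [x Ux|h]; first by apply: differentiableM; [exact: du|exact: dv].
apply: smooth_ext (smoothD oU (IH _ _ (smooth_le su) (sv' h))
  (IH _ _ (smooth_le sv) (su' h))) => // x Ux.
by rewrite pdM //; [exact: du|exact: dv].
Qed.

Lemma smooth_sum n U (I : Type) (s : seq I) (F : I -> V -> R) : open U ->
  (forall i, smooth n U (F i)) -> smooth n U (fun x => \sum_(i <- s) F i x).
Proof.
move=> oU sF; elim: s => [|i s IH].
  by apply: smooth_ext (smooth_cst n U 0) => // x _; rewrite big_nil.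
by apply: smooth_ext (smoothD oU (sF i) IH) => // x _; rewrite big_cons.
Qed.

Lemma pd_sum U (I : Type) (s : seq I) (F : I -> V -> R) x h : open U -> U x ->
  (forall i, smooth 1 U (F i)) ->
  pd h (fun x => \sum_(i <- s) F i x) x = \sum_(i <- s) pd h (F i) x.
Proof.
move=> oU Ux sF; elim: s => [|i s IH].
  rewrite big_nil -[RHS](pd_cst 0 x h); congr (pd _ _ _).
  by apply/funext => y; rewrite big_nil.
rewrite big_cons -IH -pdD; last 2 first.
- by have [d _] := sF i; exact: d.
- by have [d _] := smooth_sum s oU sF; exact: d.
by congr (pd _ _ _); apply/funext => y; rewrite big_cons.
Qed.

Lemma pdC n U u h k x : open U -> smooth n.+2 U u -> U x ->
  pd k (pd h u) x = pd h (pd k u) x.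
Proof.
move=> oU [du su] Ux.
have dd h' : differentiable (pd h' u) x by have [d _] := su h'; exact: d.
have E h' : pd h' u = (fun y => 'd u y h') by apply/funext => y; rewrite pdE.
move: (dd h) (dd k); rewrite !pdE !E; apply: schwarz.
by apply: filterS (open_nbhs_nbhs (conj oU Ux)) => y /du.
Qed.

(** Implicit differentiation: [a] and [b] stand for the derivatives of [c = t^(-1/2)] and of [t],
    and the last equation is the derivative of [c c t = 1]. *)
Lemma pd_rsqrt_aux (a b c t : R) : c != 0 -> c * c * t = 1 ->
  0 = c * c * b + t * (c * a + c * a) -> a = - 2^-1 * c ^+ 3 * b.
Proof.
move=> c0 ct e.
have Ea : 2 * c * t * a = - (c * c * b).
  by apply: (addIr (c * c * b)); rewrite addNr [RHS]e; ring.
have -> : a = c * c * t * a by rewrite ct mul1r.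
have -> : c * c * t * a = 2^-1 * c * (2 * c * t * a) by field.
by rewrite Ea; ring.
Qed.

Lemma pd_rsqrt U (s : V -> R) x h : open U -> (forall x, U x -> 0 < s x) ->
  (forall x, U x -> differentiable s x) -> U x ->
  differentiable (fun x => (Num.sqrt (s x))^-1) x /\
  pd h (fun x => (Num.sqrt (s x))^-1) x =
    - 2^-1 * (Num.sqrt (s x))^-1 ^+ 3 * pd h s x.
Proof.
move=> oU s0 ds Ux; have s0x := s0 x Ux.
have drho : differentiable (fun x => (Num.sqrt (s x))^-1) x.
  apply: differentiableV; last by rewrite gt_eqF ?sqrtr_gt0.
  apply: (differentiable_comp (ds x Ux)); apply/derivable1_diffP.
  by have [] := is_derive1_sqrt s0x.
split=> //.
have c0 : (Num.sqrt (s x))^-1 != 0 by rewrite invr_neq0 // gt_eqF ?sqrtr_gt0.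
have E y : U y -> (Num.sqrt (s y))^-1 * (Num.sqrt (s y))^-1 * s y = 1.
  move=> /s0 sy; have ssy : Num.sqrt (s y) ^+ 2 = s y by rewrite sqr_sqrtr // ltW.
  have : Num.sqrt (s y) != 0 by rewrite gt_eqF // sqrtr_gt0.
  by move: (Num.sqrt (s y)) ssy => q <- q0; field.
apply: (pd_rsqrt_aux c0 (E x Ux)).
have dM := differentiableM drho drho.
rewrite -(pdM h drho drho) -pdM //; last exact: ds.
rewrite -[LHS](pd_cst 1 x h); apply: (pd_eq h oU E Ux).
by apply: differentiableM => //; exact: ds.
Qed.

(** [pd_rsqrt] writes the derivative as a polynomial in the function itself and [pd h s], so the
    order can be raised one at a time. *)
Lemma smooth_rsqrt n U (s : V -> R) : open U -> (forall x, U x -> 0 < s x) ->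
  smooth n U s -> smooth n U (fun x => (Num.sqrt (s x))^-1).
Proof.
move=> oU s0; elim: n => [//|n IH] ss; have [ds ss'] := ss.
split=> [x Ux|h]; first exact: (pd_rsqrt 0 oU s0 ds Ux).1.
have sr := IH (smooth_le ss).
apply: smooth_ext (smoothM oU (smoothM oU (smooth_cst n U (- 2^-1))
  (smoothM oU sr (smoothM oU sr sr))) (ss' h)) => // x Ux.
by rewrite (pd_rsqrt h oU s0 ds Ux).2; ring.
Qed.

Lemma pd0_constant U u : open U -> connected U ->
  (forall x, U x -> differentiable u x) -> (forall x h, U x -> pd h u x = 0) ->
  forall x y, U x -> U y -> u x = u y.
Proof.
move=> oU cU du u0; apply: diff0_constant => // x h Ux.
by rewrite -pdE u0.
Qed.

End SmoothFunctions.

(** * Convergent sums of words *)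

Section DominatedSeries.
Variable R : realType.

Lemma series_dominated (a b : nat -> R) : (forall n, `|a n| <= b n) ->
  cvgn (series b) -> cvgn (series a) /\ `|limn (series a)| <= limn (series b).
Proof.
move=> ab cb.
have ca : cvgn [normed series a].
  apply: series_le_cvg cb => [n|n|n]; [exact: normr_ge0|exact: le_trans (normr_ge0 _) (ab n)|exact: ab].
split; first exact: normed_cvg.
by apply: (le_trans (lim_series_norm ca)); exact: lim_series_le.
Qed.

(** Sums of words and quadratic functions both come with an explicit quadratic remainder; this
    criterion converts it into differentiability with an identified derivative. *)
Lemma quadratic_diff (V : normedModType R) (u : V -> R) (df : V -> R) x C e :
  linear df -> 0 < e -> (forall h, `|df h| <= C * `|h|) ->
  (forall h, `|h| < e -> `|u (x + h) - u x - df h| <= C * `|h| ^+ 2) ->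
  differentiable u x /\ forall h, pd h u x = df h.
Proof.
move=> ldf e0 bdf q.
pose dfL : {linear V -> R} := HB.pack df (GRing.isLinear.Build _ _ _ _ _ ldf).
have dfc : continuous dfL.
  apply/linear_bounded_continuous; apply/linear_boundedP.
  apply: filterS (nbhs_pinfty_ge (num_real C)) => M CM h.
  by apply: (le_trans (bdf h)); apply: ler_wpM2r.
have C0 : 0 <= `|C| + 1 by rewrite addr_ge0.
have [//|d D] := @near_le_diff R V u dfL x dfc; last first.
  by split => // h; rewrite pdE D.
move=> eps eps0; near=> h.
have he : `|h| < e.
  by near: h; apply: nbhs0_lt.
apply: (le_trans (q h he)); rewrite expr2 mulrA ler_wpM2r //.
apply: (@le_trans _ _ ((`|C| + 1) * `|h|)).
  by rewrite ler_wpM2r // (le_trans (ler_norm _)) // lerDl.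
rewrite -ler_pdivlMl ?ltr_wpDl // mulrC; near: h; apply: nbhs0_le.
by rewrite divr_gt0 // ltr_wpDl.
Unshelve. all: by end_near. Qed.

End DominatedSeries.

Section Words.
Variables (R : realType) (r : nat).
Hypothesis r3 : (r <= 3)%N.

(* Words extended by formal sums, so as to be closed under differentiation. *)
Inductive sum_word : Type :=
| SVar
| SConj
| SCst of CD R r
| SMul of sum_word & sum_word
| SAdd of sum_word & sum_word.

Fixpoint sw_eval (w : sum_word) (z : CD R r) : CD R r :=
  match w with
  | SVar => z
  | SConj => cd_conj z
  | SCst c => c
  | SMul u v => cd_mul (sw_eval u z) (sw_eval v z)
  | SAdd u v => sw_eval u z + sw_eval v z
  end.

Fixpoint sw_der (h : CD R r) (w : sum_word) : sum_word :=
  match w with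
  | SVar => SCst h
  | SConj => SCst (cd_conj h)
  | SCst _ => SCst 0
  | SMul u v => SAdd (SMul (sw_der h u) v) (SMul u (sw_der h v))
  | SAdd u v => SAdd (sw_der h u) (sw_der h v)
  end.

(* Replacing [z], [z~] by [t] and constants by their moduli gives a polynomial
   in [t] with nonnegative coefficients that dominates the word for
   [|z| <= t]; [sw_dmaj] is its derivative. *)
Fixpoint sw_maj (w : sum_word) (t : R) : R :=
  match w with
  | SVar | SConj => t
  | SCst c => cd_abs c
  | SMul u v => sw_maj u t * sw_maj v t
  | SAdd u v => sw_maj u t + sw_maj v t
  end.

Fixpoint sw_dmaj (w : sum_word) (t : R) : R :=
  match w with
  | SVar | SConj => 1
  | SCst _ => 0
  | SMul u v => sw_dmaj u t * sw_maj v t + sw_maj u t * sw_dmaj v t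
  | SAdd u v => sw_dmaj u t + sw_dmaj v t
  end.

Lemma sw_maj_ge0 w t : 0 <= t -> 0 <= sw_maj w t.
Proof.
move=> t0; elim: w => //= [c|u IHu v IHv|u IHu v IHv]; first exact: cd_abs_ge0.
  exact: mulr_ge0.
exact: addr_ge0.
Qed.

Lemma sw_dmaj_ge0 w t : 0 <= t -> 0 <= sw_dmaj w t.
Proof.
move=> t0; elim: w => //= [u IHu v IHv|u IHu v IHv].
  by rewrite addr_ge0 // mulr_ge0 // sw_maj_ge0.
exact: addr_ge0.
Qed.

(** A polynomial with nonnegative coefficients lies above its tangents on [t >= 0]. It is used as a
    Cauchy estimate: the derivative at [t] is at most the value at a larger radius [s], divided by
    [s - t]. *)
Lemma sw_maj_convex w t s : 0 <= t <= s ->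
  (s - t) * sw_dmaj w t <= sw_maj w s - sw_maj w t.
Proof.
move=> /andP[t0 ts]; have s0 : 0 <= s := le_trans t0 ts.
elim: w => //= [||c|u IHu v IHv|u IHu v IHv].
- by rewrite mulr1.
- by rewrite mulr1.
- by rewrite subrr mulr0.
- have u0 := sw_maj_ge0 u t0; have v0 := sw_maj_ge0 v t0.
  have du0 := sw_dmaj_ge0 u t0.
  have dv0 := sw_dmaj_ge0 v t0; have st0 : 0 <= s - t by rewrite subr_ge0.
  have := mulr_ge0 st0 dv0; have := mulr_ge0 st0 du0; move: IHu IHv.
  set a := (s - t) * sw_dmaj u t; set b := (s - t) * sw_dmaj v t => IHu IHv a0 b0.
  have us : sw_maj u t + a <= sw_maj u s by rewrite addrC -lerBrDr.
  have vs : sw_maj v t + b <= sw_maj v s by rewrite addrC -lerBrDr.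
  have := ler_pM (addr_ge0 u0 a0) (addr_ge0 v0 b0) us vs.
  have := mulr_ge0 a0 b0.
  have -> : (s - t) * (sw_dmaj u t * sw_maj v t + sw_maj u t * sw_dmaj v t) =
    a * sw_maj v t + sw_maj u t * b by rewrite /a /b; ring.
  by lra.
- by rewrite mulrDr; lra.
Qed.

Lemma sw_maj_der h w t : sw_maj (sw_der h w) t = cd_abs h * sw_dmaj w t.
Proof.
elim: w => //= [|||u -> v ->|u -> v ->].
- by rewrite mulr1.
- by rewrite cd_abs_conj mulr1.
- by rewrite cd_abs0 mulr0.
- by ring.
- by ring.
Qed.

Lemma sw_eval_le w z t : cd_abs z <= t -> cd_abs (sw_eval w z) <= sw_maj w t.
Proof.
move=> zt; elim: w => //= [|u IHu v IHv|u IHu v IHv].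
- by rewrite cd_abs_conj.
- by rewrite cd_absM // ler_pM // cd_abs_ge0.
- exact: le_trans (cd_absD _ _) (lerD IHu IHv).
Qed.

Lemma sw_der_linear w z : linear (fun h => sw_eval (sw_der h w) z).
Proof.
move=> a h k; elim: w => //= [||u IHu v IHv|u IHu v IHv].
- by rewrite cd_conjD cd_conjZ.
- by rewrite scaler0 addr0.
- by rewrite IHu IHv !cd_lin cd_mulZl cd_mulZr scalerDr addrACA.
- by rewrite IHu IHv scalerDr addrACA.
Qed.

(** For the majorant [m], the increment is at most [m(t + |h|) - m(t)], and by convexity the slope
    of this chord is at most that of the chord up to [s]. The form multiplied by [s - t] is the one
    that passes through products in the induction. *)
Lemma sw_incr_le w z h t s : cd_abs z <= t -> t < s -> cd_abs h <= s - t ->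
  (s - t) * cd_abs (sw_eval w (z + h) - sw_eval w z)
  <= cd_abs h * (sw_maj w s - sw_maj w t).
Proof.
move=> zt ts hst; have t0 : 0 <= t := le_trans (cd_abs_ge0 _) zt.
have zhs : cd_abs (z + h) <= s by apply: le_trans (cd_absD _ _) _; lra.
have st0 : 0 <= s - t by rewrite subr_ge0 ltW.
elim: w => //= [||c|u IHu v IHv|u IHu v IHv].
- by rewrite addrAC subrr add0r mulrC.
- by rewrite cd_conjD addrAC subrr add0r cd_abs_conj mulrC.
- by rewrite !subrr cd_abs0 !mulr0.
- rewrite (_ : _ - _ = cd_mul (sw_eval u (z + h) - sw_eval u z) (sw_eval v (z + h))
     + cd_mul (sw_eval u z) (sw_eval v (z + h) - sw_eval v z)); last first.
    by rewrite !cd_lin addrA subrK.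
  apply: le_trans (ler_wpM2l st0 (cd_absD _ _)) _.
  rewrite mulrDr !cd_absM // mulrA [X in _ + X]mulrCA.
  have -> : cd_abs h * (sw_maj u s * sw_maj v s - sw_maj u t * sw_maj v t) =
    cd_abs h * (sw_maj u s - sw_maj u t) * sw_maj v s +
    sw_maj u t * (cd_abs h * (sw_maj v s - sw_maj v t)) by ring.
  apply: lerD; apply: ler_pM => //; rewrite ?mulr_ge0 ?cd_abs_ge0 //.
    exact: sw_eval_le.
  exact: sw_eval_le.
- rewrite (_ : _ - _ = (sw_eval u (z + h) - sw_eval u z) +
     (sw_eval v (z + h) - sw_eval v z)); last by rewrite opprD addrACA.
  apply: le_trans (ler_wpM2l st0 (cd_absD _ _)) _.
  rewrite mulrDr; apply: le_trans (lerD IHu IHv) _.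
  by rewrite -mulrDr le_eqVlt; apply/orP; left; apply/eqP; ring.
Qed.

(** The same principle one order higher: with nonnegative coefficients,
    [(m(t + d) - m(t) - d m'(t)) / d^2] increases with [d], here from [|h|] to [s - t]. The
    remainder is thus quadratic in [h] with a factor that can be summed over words. *)
Lemma sw_taylor_le w z h t s : cd_abs z <= t -> t < s -> cd_abs h <= s - t ->
  (s - t) ^+ 2 *
    cd_abs (sw_eval w (z + h) - sw_eval w z - sw_eval (sw_der h w) z)
  <= cd_abs h ^+ 2 * (sw_maj w s - sw_maj w t - (s - t) * sw_dmaj w t).
Proof.
move=> zt ts hst; have t0 : 0 <= t := le_trans (cd_abs_ge0 _) zt.
have zhs : cd_abs (z + h) <= s by apply: le_trans (cd_absD _ _) _; lra.
have st0 : 0 <= s - t by rewrite subr_ge0 ltW.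
elim: w => //= [||c|u IHu v IHv|u IHu v IHv].
- by rewrite [z + h]addrC addrK subrr cd_abs0 mulr1 subrr !mulr0.
- by rewrite [z + h]addrC cd_conjD addrK subrr cd_abs0 mulr1 subrr !mulr0.
- by rewrite !subrr cd_abs0 !mulr0 subrr mulr0.
- pose du := sw_eval (sw_der h u) z; pose dv := sw_eval (sw_der h v) z.
  (* The remainder of a product consists of the remainder of [u], that of [v], and the derivative of
     [u] times the increment of [v]; the last is where [sw_incr_le] enters. *)
  rewrite (_ : _ - _ - _ =
    cd_mul (sw_eval u (z + h) - sw_eval u z - du) (sw_eval v (z + h))
    + cd_mul (sw_eval u z) (sw_eval v (z + h) - sw_eval v z - dv)
    + cd_mul du (sw_eval v (z + h) - sw_eval v z)); last first.
    by rewrite !cd_lin -/du -/dv; apply/rowP => i; rewrite !mxE; ring.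
  apply: le_trans (ler_wpM2l (sqr_ge0 _) (le_trans (cd_absD _ _)
    (lerD (cd_absD _ _) (lexx _)))) _.
  rewrite !cd_absM // [leLHS]mulrDr [X in X + _ <= _]mulrDr.
  have -> : cd_abs h ^+ 2 * (sw_maj u s * sw_maj v s - sw_maj u t * sw_maj v t -
    (s - t) * (sw_dmaj u t * sw_maj v t + sw_maj u t * sw_dmaj v t)) =
    cd_abs h ^+ 2 * (sw_maj u s - sw_maj u t - (s - t) * sw_dmaj u t) * sw_maj v s +
    sw_maj u t * (cd_abs h ^+ 2 * (sw_maj v s - sw_maj v t - (s - t) * sw_dmaj v t)) +
    ((s - t) * (cd_abs h * sw_dmaj u t)) * (cd_abs h * (sw_maj v s - sw_maj v t)).
    by ring.
  apply: lerD; first apply: lerD.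
  + by rewrite mulrA; apply: ler_pM => //;
      rewrite ?mulr_ge0 ?sqr_ge0 ?cd_abs_ge0 // sw_eval_le.
  + by rewrite mulrCA; apply: ler_pM => //;
      rewrite ?mulr_ge0 ?sqr_ge0 ?cd_abs_ge0 // sw_eval_le.
  + rewrite expr2 mulrACA; apply: ler_pM; rewrite ?mulr_ge0 ?cd_abs_ge0 //.
      by rewrite ler_wpM2l // -sw_maj_der sw_eval_le.
    exact: sw_incr_le.
- pose du := sw_eval (sw_der h u) z; pose dv := sw_eval (sw_der h v) z.
  rewrite (_ : _ - _ - _ = (sw_eval u (z + h) - sw_eval u z - du) +
     (sw_eval v (z + h) - sw_eval v z - dv)); last first.
    by rewrite -/du -/dv; apply/rowP => i; rewrite !mxE; ring.
  apply: le_trans (ler_wpM2l (sqr_ge0 _) (cd_absD _ _)) _.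
  rewrite mulrDr; apply: le_trans (lerD IHu IHv) _.
  by rewrite -mulrDr le_eqVlt; apply/orP; left; apply/eqP; ring.
Qed.

(** Stated for majorants at real radii and not for values at points: the sums created by [sw_der]
    may cancel at a point, while the majorants stay controlled under differentiation. *)
Definition sw_summable (nu : nat -> sum_word) (rho : R) : Prop :=
  forall s, 0 <= s < rho -> cvgn (series (fun n => sw_maj (nu n) s)).

Definition sw_sum (nu : nat -> sum_word) (a : CD R r) i (z : CD R r) : R :=
  limn (series (fun n => sw_eval (nu n) (z - a) 0 i)).

Lemma sw_summable_cvg nu rho (z : CD R r) i : sw_summable nu rho ->
  cd_abs z < rho -> cvgn (series (fun n => sw_eval (nu n) z 0 i)).
Proof.
move=> nus zrho.
have zr : 0 <= cd_abs z < rho by rewrite cd_abs_ge0.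
have H n : `|sw_eval (nu n) z 0 i| <= sw_maj (nu n) (cd_abs z).
  exact: le_trans (le_coord_cd_abs _ _) (sw_eval_le _ (lexx _)).
exact: (series_dominated H (nus _ zr)).1.
Qed.

(** A little radius is traded for a derivative: by [sw_maj_convex] the derived majorant at [t] is at
    most [|h| / (s - t)] times the majorant at the midpoint [s] of [t] and [rho]. *)
Lemma sw_summable_der nu rho h : sw_summable nu rho ->
  sw_summable (fun n => sw_der h (nu n)) rho.
Proof.
move=> nus t /andP[t0 tr]; pose s := (t + rho) / 2.
have ts : t < s by rewrite /s; lra.
have sr : 0 <= s < rho by rewrite /s; apply/andP; split; lra.
have st : 0 < s - t by rewrite subr_gt0.
suff H n : `|sw_maj (sw_der h (nu n)) t| <=
    cd_abs h / (s - t) * sw_maj (nu n) s.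
  have cb := is_cvg_seriesZ (k := cd_abs h / (s - t)) (nus s sr).
  exact: (series_dominated H cb).1.
have m0 : 0 <= sw_maj (nu n) t := sw_maj_ge0 _ t0.
rewrite sw_maj_der ger0_norm ?mulr_ge0 ?cd_abs_ge0 ?sw_dmaj_ge0 //.
rewrite -mulrA; apply: ler_wpM2l; first exact: cd_abs_ge0.
rewrite ler_pdivlMl //; apply: le_trans (sw_maj_convex _ _) _.
  by rewrite t0 ltW.
by rewrite lerBlDr lerDl.
Qed.

Lemma sw_sum_diff nu a rho i z : sw_summable nu rho -> cd_abs (z - a) < rho ->
  differentiable (sw_sum nu a i) z /\
  forall h, pd h (sw_sum nu a i) z = sw_sum (fun n => sw_der h (nu n)) a i z.
Proof.
move=> nus zr; set y := z - a in zr *.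
pose t := cd_abs y; pose s := (t + rho) / 2.
have t0 : 0 <= t := cd_abs_ge0 _.
have tr : t < rho := zr.
have ts : t < s by rewrite /s; lra.
have sr : 0 <= s < rho by rewrite /s; apply/andP; split; lra.
have st : 0 < s - t by rewrite subr_gt0.
pose N : R := (cd_dim r)%:R; have N0 : 0 <= N by exact: ler0n.
pose M := limn (series (fun n => sw_maj (nu n) s)).
have cM := nus s sr.
have M0 : 0 <= M.
  apply: limr_ge => //; apply: nearW => n; apply: sumr_ge0 => k _.
  by rewrite sw_maj_ge0 //; case/andP: sr.
have cder h : cvgn (series (fun n => sw_eval (sw_der h (nu n)) y 0 i)).
  exact: (sw_summable_cvg (i := i) (sw_summable_der (h := h) nus) zr).
(* both the derivative and the Taylor remainder are dominated termwise by
   multiples of the majorant at [s] *)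
have bd h : `|sw_sum (fun n => sw_der h (nu n)) a i z| <= cd_abs h / (s - t) * M.
  have H n : `|sw_eval (sw_der h (nu n)) y 0 i| <=
      cd_abs h / (s - t) * sw_maj (nu n) s.
    apply: le_trans (le_coord_cd_abs _ _) _.
    apply: le_trans (sw_eval_le _ (lexx _)) _.
    rewrite sw_maj_der -mulrA ler_wpM2l ?cd_abs_ge0 // ler_pdivlMl //.
    apply: le_trans (sw_maj_convex _ _) _; first by rewrite t0 ltW.
    by rewrite lerBlDr lerDl sw_maj_ge0.
  have cb := is_cvg_seriesZ (k := cd_abs h / (s - t)) cM.
  apply: le_trans (series_dominated H cb).2 _.
  by rewrite -[_ * M]/(_ *: M) -lim_seriesZ.
have tl h : cd_abs h <= s - t ->
    `|sw_sum nu a i (z + h) - sw_sum nu a i z -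
      sw_sum (fun n => sw_der h (nu n)) a i z| <= (cd_abs h / (s - t)) ^+ 2 * M.
  move=> hst.
  have yh : cd_abs (y + h) < rho.
    by apply: le_lt_trans (cd_absD _ _) _; case/andP: sr => _; rewrite -/t; lra.
  have H n : `|(sw_eval (nu n) (y + h) 0 i - sw_eval (nu n) y 0 i -
        sw_eval (sw_der h (nu n)) y 0 i)| <=
      (cd_abs h / (s - t)) ^+ 2 * sw_maj (nu n) s.
    have := le_coord_cd_abs (sw_eval (nu n) (y + h) - sw_eval (nu n) y -
        sw_eval (sw_der h (nu n)) y) i; rewrite !mxE => /le_trans; apply.
    rewrite exprMn exprVn -mulrA [_^-1 * _]mulrC mulrA ler_pdivlMr ?exprn_gt0 //.
    rewrite mulrC; apply: le_trans (sw_taylor_le _ (lexx _) ts hst) _.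
    rewrite ler_wpM2l ?sqr_ge0 // -addrA gerDl -opprD oppr_le0.
    by rewrite addr_ge0 ?mulr_ge0 ?sw_maj_ge0 ?sw_dmaj_ge0 // ltW.
  have cb := is_cvg_seriesZ (k := (cd_abs h / (s - t)) ^+ 2) cM.
  have := (series_dominated H cb).2.
  rewrite -[_ * M]/(_ *: M) -lim_seriesZ //.
  suff -> : limn (series (fun n => sw_eval (nu n) (y + h) 0 i -
      sw_eval (nu n) y 0 i - sw_eval (sw_der h (nu n)) y 0 i)) =
    sw_sum nu a i (z + h) - sw_sum nu a i z -
      sw_sum (fun n => sw_der h (nu n)) a i z by [].
  have c1 := sw_summable_cvg (i := i) nus yh; have c2 := sw_summable_cvg (i := i) nus zr.
  rewrite /sw_sum (_ : z + h - a = y + h); last by rewrite addrAC.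
  rewrite -/y; set F := fun n => sw_eval _ (y + h) 0 i.
  set G := fun n => sw_eval (nu n) y 0 i; set D := fun n => sw_eval _ y 0 i.
  have cFG : cvgn (series (F - G)) by exact: is_cvg_seriesB.
  by rewrite -[X in series X]/(F - G - D) (lim_seriesB cFG (cder h)) lim_seriesB.
(* One constant for both bounds of [quadratic_diff]: the first summand serves the derivative, the
   second the remainder. [N] passes from [cd_abs] to the maximum norm, and the radius
   [(s - t) / (N + 1)] below ensures [cd_abs h <= s - t]. *)
pose C := (N / (s - t) + (N / (s - t)) ^+ 2) * M.
have st0 := ltW st.
have A0 : 0 <= N / (s - t) by rewrite divr_ge0.
have A2 : 0 <= (N / (s - t)) ^+ 2 by rewrite sqr_ge0.
apply: (@quadratic_diff _ _ _ _ z C ((s - t) / (N + 1))).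
- move=> k h h'; rewrite /sw_sum -/y -lim_seriesZ // -lim_seriesD //; last first.
    exact: is_cvg_seriesZ.
  congr (limn (series _)); apply/funext => n.
  by rewrite sw_der_linear !mxE.
- by rewrite divr_gt0 // ltr_wpDl.
- move=> h; apply: le_trans (bd h) _; rewrite /C mulrDl mulrDl.
  apply: le_trans (_ : N / (s - t) * M * `|h| <= _); last first.
    by rewrite lerDl mulr_ge0 // mulr_ge0.
  rewrite [leRHS]mulrAC ler_wpM2r // [leRHS]mulrAC ler_wpM2r ?invr_ge0 //.
  exact: le_cd_abs_norm.
- move=> h hst.
  have hN := le_cd_abs_norm h.
  have hst' : cd_abs h <= s - t.
    have N1 : 0 < N + 1 by rewrite ltr_wpDl.
    move: hst; rewrite ltr_pdivlMr // => hst.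
    apply: (le_trans hN); apply: le_trans (ltW hst).
    by rewrite mulrC ler_wpM2l // lerDl.
  apply: le_trans (tl h hst') _; rewrite /C mulrDl mulrDl.
  apply: le_trans (_ : (N / (s - t)) ^+ 2 * M * `|h| ^+ 2 <= _); last first.
    by rewrite lerDr mulr_ge0 ?exprn_ge0 // mulr_ge0.
  rewrite [leRHS]mulrAC ler_wpM2r // -exprMn [X in _ <= X ^+ 2]mulrAC.
  by rewrite ler_sqr ?nnegrE ?mulr_ge0 ?invr_ge0 ?cd_abs_ge0 // ler_wpM2r ?invr_ge0.
Qed.

Lemma open_cd_ball a (rho : R) : open [set z : CD R r | cd_abs (z - a) < rho].
Proof.
rewrite openE => z /= zr.
pose e := (rho - cd_abs (z - a)) / ((cd_dim r)%:R + 1).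
have e0 : 0 < e by rewrite divr_gt0 ?subr_gt0 // ltr_wpDl.
apply/nbhs_ballP; exists e => // y; rewrite -ball_normE /= => yz.
rewrite (_ : y - a = (z - a) + (y - z)); last by rewrite [RHS]addrC addrA subrK.
apply: le_lt_trans (cd_absD _ _) _; rewrite -ltrBrDl.
apply: le_lt_trans (le_cd_abs_norm _) _; rewrite distrC.
have N1 : 0 < (cd_dim r)%:R + 1 :> R by rewrite ltr_wpDl.
move: yz; rewrite ltr_pdivlMr //; apply: le_lt_trans.
by rewrite mulrC ler_wpM2l // lerDl.
Qed.

Lemma smooth_sw_sum n nu a rho i : sw_summable nu rho ->
  smooth n [set z | cd_abs (z - a) < rho] (sw_sum nu a i).
Proof.
elim: n nu => [//|n IH] nu nus; split=> [z zr|h].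
  exact: (sw_sum_diff _ nus zr).1.
apply: smooth_ext (IH _ (sw_summable_der (h := h) nus)); first exact: open_cd_ball.
by move=> z zr; rewrite (sw_sum_diff _ nus zr).2.
Qed.

Fixpoint sw_of (w : cd_word R r) : sum_word :=
  match w with
  | WVar => SVar
  | WConj => SConj
  | WCst c => SCst c
  | WMul u v => SMul (sw_of u) (sw_of v)
  end.

Lemma sw_eval_of w z : sw_eval (sw_of w) z = word_eval w z.
Proof. by elim: w => //= u -> v ->. Qed.

Lemma sw_der_of w z h :
  sw_eval (sw_der h (sw_of w)) z = word_dz w z h + word_dzb w z h.
Proof.
elim: w => //= [|||u IHu v IHv]; rewrite ?addr0 ?add0r //.
by rewrite IHu IHv !sw_eval_of !cd_lin addrACA.
Qed.

Lemma sw_maj_of w z : sw_maj (sw_of w) (cd_abs z) = cd_abs (word_eval w z).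
Proof.
by elim: w => //= [|u -> v ->]; rewrite ?cd_abs_conj ?cd_absM.
Qed.

(** Since the modulus is multiplicative and words contain no sums, the majorant at [s] is the
    modulus of the word at any point of modulus [s]; the real point [s 1], translated by [a], serves
    as test point. *)
Lemma phrase_cvg_summable nu a rho : phrase_cvg nu a rho ->
  sw_summable (fun n => sw_of (nu n)) rho.
Proof.
move=> nuc s /andP[s0 sr].
have E : cd_abs (s *: cd_one R r) = s by rewrite cd_absZ cd_abs1 mulr1 ger0_norm.
rewrite (_ : (fun n => _) = fun n => cd_abs (word_eval (nu n) (s *: cd_one R r))).
  by have := nuc (a + s *: cd_one R r); rewrite addrAC subrr add0r E; apply.
by apply/funext => n; rewrite -sw_maj_of E.
Qed.

End Words.

(** * Quadratic functions and functions with isotropic Hessian *)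

Section QuadraticFunctions.
Variables (R : realType) (n : nat).
Implicit Types x h p : 'rV[R]_n.

Lemma dot_le x h : `|dot h x| <= (\sum_i `|x 0 i|) * `|h|.
Proof.
rewrite mulr_suml; apply: le_trans (ler_norm_sum _ _ _) _.
by apply: ler_sum => i _; rewrite normrM mulrC ler_wpM2l // le_coord_norm.
Qed.

Lemma diff_dot_affine p k x : differentiable (fun x => dot (x - p) k) x /\
  forall h, pd h (fun x => dot (x - p) k) x = dot h k.
Proof.
apply: (@quadratic_diff _ _ _ _ x (\sum_i `|k 0 i|) 1) => //.
- by move=> a h h'; rewrite dotDl dotZl.
- by move=> h; exact: dot_le.
- move=> h _; rewrite [x + h - p]addrAC; move: (x - p) => y; rewrite dotDl addrAC addrK subrr normr0.
  by rewrite mulr_ge0 ?sqr_ge0 // sumr_ge0.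
Qed.

Lemma diff_dot_sqr p x : differentiable (fun x => dot (x - p) (x - p)) x /\
  forall h, pd h (fun x => dot (x - p) (x - p)) x = 2 * dot (x - p) h.
Proof.
pose S := \sum_i `|(x - p) 0 i|; have S0 : 0 <= S by rewrite sumr_ge0.
apply: (@quadratic_diff _ _ _ _ x (2 * S + n%:R) 1) => //.
- by move=> a h h'; rewrite dotDr dotZr mulrDr mulrCA.
- move=> h; rewrite normrM (ger0_norm (ler0n R 2)) dotC.
  have H := dot_le (x - p) h; rewrite -/S in H.
  have n0 : 0 <= n%:R * `|h| by rewrite mulr_ge0.
  by lra.
- move=> h _; rewrite [x + h - p]addrAC; move: (x - p) => y; rewrite !(dotDl, dotDr) (dotC h y).
  rewrite (_ : _ - _ = dot h h); last by ring.
  apply: le_trans (dot_le _ _) _; rewrite expr2 mulrA ler_wpM2r //.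
  apply: (@le_trans _ _ (n%:R * `|h|)); last by rewrite ler_wpM2r // lerDr mulr_ge0.
  rewrite mulr_natl -[X in _ *+ X]card_ord -sumr_const; apply: ler_sum => i _.
  exact: le_coord_norm.
Qed.

End QuadraticFunctions.

Section IsotropicHessian.
Variables (R : realType) (n : nat).
Implicit Types (x h k l : 'rV[R]_n) (U : set 'rV[R]_n) (u : 'rV[R]_n -> R).
Let e (i : 'I_n) : 'rV[R]_n := delta_mx 0 i.

Lemma pd_basis u x h : pd h u x = \sum_i h 0 i * pd (e i) u x.
Proof. by rewrite {1}[h]row_sum_delta pd_sumr. Qed.

Lemma pd2_basis m U u x h k : open U -> smooth m.+2 U u -> U x ->
  pd k (pd h u) x = \sum_i \sum_j k 0 i * h 0 j * pd (e i) (pd (e j) u) x.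
Proof.
move=> oU su Ux; rewrite pd_basis; apply: eq_bigr => i _.
rewrite (pdC _ _ oU su Ux) pd_basis mulr_sumr; apply: eq_bigr => j _.
by rewrite (pdC _ _ oU su Ux) mulrA.
Qed.

Lemma dot_basis i j : dot (e i) (e j) = (i == j)%:R.
Proof. by rewrite dot_deltal mxE eqxx. Qed.

(** [tau] equals every [u_ii], and the argument runs on these because [tau] is not assumed
    differentiable. Along [e_k], pick [i != k]: then [u_iik] is the derivative along [e_i] of
    [u_ik], which vanishes on [U]. *)
Lemma isotropic_hessian_constant U u (tau : 'rV[R]_n -> R) : (1 < n)%N ->
  open U -> connected U -> smooth 3 U u ->
  (forall x h k, U x -> pd k (pd h u) x = tau x * dot h k) ->
  forall x y, U x -> U y -> tau x = tau y.
Proof.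
move=> n1 oU cU su Hu.
have su2 h : smooth 2 U (pd h u) by exact: smooth_pd.
have su1 h k : smooth 1 U (pd k (pd h u)) by apply: smooth_pd.
have tauE i x : U x -> pd (e i) (pd (e i) u) x = tau x.
  by move=> Ux; rewrite Hu // dot_basis eqxx mulr1.
pose i0 := Ordinal (ltnW n1).
suff H : forall x y, U x -> U y ->
    pd (e i0) (pd (e i0) u) x = pd (e i0) (pd (e i0) u) y.
  by move=> x y Ux Uy; rewrite -(tauE i0 x) // -(tauE i0 y) //; exact: H.
apply: pd0_constant => // [x Ux|x h Ux].
  exact: smooth_diff (su1 _ _) Ux.
rewrite pd_basis big1 // => k _.
have [i ik] : exists i, i != k.
  pose i1 := Ordinal n1.
  by have [->|] := eqVneq k i0; [exists i1|exists i0; rewrite eq_sym].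
rewrite (@pd_eq _ _ U (pd (e i) (pd (e i) u)) _ x (e k) oU _ Ux).
- rewrite (pdC _ _ oU (su2 (e i)) Ux).
  rewrite (@pd_eq _ _ U (fun=> 0)) ?pd_cst ?mulr0 //.
  by move=> y Uy; rewrite Hu // dot_basis (negbTE ik) mulr0.
- by move=> y Uy; rewrite !tauE.
- exact: smooth_diff (su1 _ _) Ux.
Qed.

End IsotropicHessian.

(** * Liouville's theorem *)

Section Liouville.
Variables (R : realType) (n : nat) (U : set 'rV[R]_n).
Variable f : 'I_n -> 'rV[R]_n -> R.
Hypotheses (n2 : (2 < n)%N) (oU : open U) (cU : connected U).
Hypothesis smf : forall m, smooth 4 U (f m).
Hypothesis conf : forall x, U x -> exists2 s, 0 < s & forall h k,
  \sum_m pd h (f m) x * pd k (f m) x = s * dot h k.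
Implicit Types (x h k l : 'rV[R]_n).

Let e (i : 'I_n) : 'rV[R]_n := delta_mx 0 i.
Let i0 : 'I_n := Ordinal (ltnW (ltnW n2)).

(** The square of the scale. Reading it off from one basis vector shows that it is smooth, while
    [conf] supplies only a number at each point. *)
Let s x : R := \sum_m pd (e i0) (f m) x * pd (e i0) (f m) x.
Let rho x : R := (Num.sqrt (s x))^-1.
Let w m x : R := \sum_i pd (e i) rho x * pd (e i) (f m) x.

Let sE x : U x ->
  0 < s x /\ forall h k, \sum_m pd h (f m) x * pd k (f m) x = s x * dot h k.
Proof.
move=> Ux; have [t t0 H] := conf Ux.
suff -> : s x = t by [].
by rewrite /s H dot_basis eqxx mulr1.
Qed.

Let s_gt0 x : U x -> 0 < s x. Proof. by move=> /sE[]. Qed.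

Let sms : smooth 3 U s.
Proof.
apply: smooth_sum => // m; apply: smoothM => //; exact: smooth_pd.
Qed.

Let smrho : smooth 3 U rho. Proof. exact: smooth_rsqrt. Qed.

Let rho_gt0 x : U x -> 0 < rho x.
Proof. by move=> Ux; rewrite invr_gt0 sqrtr_gt0 s_gt0. Qed.

Let rho_s x : U x -> rho x ^+ 2 * s x = 1.
Proof.
move=> Ux; have s0 := s_gt0 Ux.
by rewrite /rho exprVn sqr_sqrtr ?ltW // mulVf // gt_eqF.
Qed.

Let pd_s x h : U x -> rho x * pd h s x = - 2 * s x * pd h rho x.
Proof.
move=> Ux; have [_ ->] := pd_rsqrt h oU s_gt0 (fun y => smooth_diff sms (x := y)) Ux.
rewrite -/(rho x) (_ : _ * _ * _ = (rho x ^+ 2 * s x) * (rho x * pd h s x)).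
  by rewrite rho_s // mul1r.
by field.
Qed.

Let smf2 m h : smooth 3 U (pd h (f m)). Proof. exact: smooth_pd. Qed.

Let dfh m h x : U x -> differentiable (pd h (f m)) x.
Proof. exact: smooth_diff. Qed.

Let dfm m x : U x -> differentiable (f m) x.
Proof. exact: smooth_diff. Qed.

(** As for the Levi-Civita connection: [f_hk] is symmetric in [h] and [k], and differentiating
    [<f_h, f_k> = s <h, k>] along [l], in three permutations, determines [<f_hk, f_l>]. *)
Let christoffel x h k l : U x ->
  2 * (\sum_m pd k (pd h (f m)) x * pd l (f m) x) =
  pd k s x * dot h l + pd h s x * dot l k - pd l s x * dot h k.
Proof.
move=> Ux; pose C h k l := \sum_m pd k (pd h (f m)) x * pd l (f m) x.
have CC h' k' l' : C h' k' l' = C k' h' l'.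
  by apply: eq_bigr => m _; rewrite (pdC _ _ oU (smf m) Ux).
have CD h' k' l' : C h' l' k' + C k' l' h' = pd l' s x * dot h' k'.
  pose F m y := pd h' (f m) y * pd k' (f m) y.
  have smF m : smooth 1 U (F m).
    by apply: smoothM => //; do 2!apply: smooth_le; exact: smf2.
  have smS := smooth_sum (index_enum 'I_n) oU smF.
  transitivity (pd l' (fun y => \sum_m F m y) x).
    rewrite (pd_sum _ _ oU Ux smF) /C -big_split; apply: eq_bigr => m _.
    rewrite (pdM l' (dfh m h' Ux) (dfh m k' Ux)) /=; ring.
  rewrite -(pd_eq (U := U) l' oU _ Ux (smooth_diff smS Ux) (v := fun y => s y * dot h' k')).
    have ds := smooth_diff sms Ux.
    have dc : differentiable (fun=> dot h' k' : R) x by exact: differentiable_cst.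
    by rewrite (pdM _ ds dc) pd_cst mulr0 add0r mulrC.
  by move=> y Uy; rewrite /F (sE Uy).2.
rewrite -/(C h k l).
have := CD h l k; have := CD l k h; have := CD h k l.
rewrite (CC k l h) (CC l h k) (CC k h l) (dotC l k) => E1 E2 E3.
by rewrite -E1 -E3 -E2; ring.
Qed.

(** Conformality gives [J J^T = s] for the Jacobian, so [J] is invertible and identities between
    vectors may be tested against all [f_l]. *)
Let frame x (z : 'I_n -> R) : U x ->
  (forall l, \sum_m z m * pd l (f m) x = 0) -> forall m, z m = 0.
Proof.
move=> Ux H m; have [s0 sx] := sE Ux.
pose J : 'M[R]_n := \matrix_(l, m) pd (e l) (f m) x.
pose Z : 'rV[R]_n := \row_m z m.
have JJ : ((s x)^-1 *: J) *m J^T = 1%:M.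
  apply/matrixP => i j; rewrite -scalemxAl !mxE.
  under eq_bigr do rewrite !mxE.
  by rewrite sx dot_basis mulKf // gt_eqF.
have ZJ : Z *m J^T = 0.
  apply/rowP => l; rewrite !mxE -[RHS](H (e l)); apply: eq_bigr => j _.
  by rewrite !mxE.
have : Z = 0 by rewrite -[Z]mulmx1 -(mulmx1C JJ) mulmxA ZJ mul0mx.
by move=> /rowP/(_ m); rewrite !mxE.
Qed.

(** Tested against each [f_l]: [christoffel] and [rho s_k = - 2 s rho_k] cancel everything on the
    left except [s rho_l <h, k>], and [s rho_l] is the product of [w] with [f_l]. *)
Let rho_f2 x h k m : U x ->
  rho x * pd k (pd h (f m)) x + pd k rho x * pd h (f m) x
    + pd h rho x * pd k (f m) x = dot h k * w m x.
Proof.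
move=> Ux; apply/eqP; rewrite -subr_eq0; apply/eqP; move: m.
apply: (frame Ux) => l; have [s0 sx] := sE Ux.
transitivity (rho x * (\sum_m pd k (pd h (f m)) x * pd l (f m) x)
  + pd k rho x * (\sum_m pd h (f m) x * pd l (f m) x)
  + pd h rho x * (\sum_m pd k (f m) x * pd l (f m) x)
  - dot h k * (\sum_i pd (e i) rho x * (\sum_m pd (e i) (f m) x * pd l (f m) x))).
  rewrite /w !mulr_sumr; under [X in - X]eq_bigr do rewrite !mulr_sumr.
  rewrite exchange_big -!big_split -sumrB; apply: eq_bigr => m _ /=.
  by rewrite mulr_sumr mulrBl !mulrDl mulr_suml; congr (_ - _); rewrite ?mulrA //;
   apply: eq_bigr => i _; rewrite !mulrA.
have -> : \sum_i pd (e i) rho x * (\sum_m pd (e i) (f m) x * pd l (f m) x) =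
    s x * pd l rho x.
  rewrite pd_basis mulr_sumr; apply: eq_bigr => i _.
  by rewrite sx dot_deltal; ring.
rewrite !sx.
have -> : \sum_m pd k (pd h (f m)) x * pd l (f m) x =
    2^-1 * (pd k s x * dot h l + pd h s x * dot l k - pd l s x * dot h k).
  by rewrite -christoffel // mulrA mulVf ?mul1r.
have -> : rho x * (2^-1 *
  (pd k s x * dot h l + pd h s x * dot l k - pd l s x * dot h k)) =
  2^-1 * (rho x * pd k s x * dot h l + rho x * pd h s x * dot l k
          - rho x * pd l s x * dot h k) by ring.
by rewrite !pd_s // (dotC l k); field.
Qed.

Let g m x : R := rho x * f m x.

Let smg m : smooth 3 U (g m).
Proof. by apply: smoothM => //; exact: smooth_le. Qed.

Let drho x : U x -> differentiable rho x.
Proof. exact: (smooth_diff smrho). Qed.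

Let drho1 h x : U x -> differentiable (pd h rho) x.
Proof. by move=> Ux; exact: (smooth_diff (smooth_pd h smrho) Ux). Qed.

Let pd_g m x h : U x -> pd h (g m) x = rho x * pd h (f m) x + f m x * pd h rho x.
Proof. by move=> Ux; rewrite (pdM h (drho Ux) (dfm m Ux)). Qed.

(** In the Leibniz expansion the terms with derivatives of [f] are the left side of [rho_f2]. Hence
    for orthogonal [h], [k] the Hessian of [rho f] is just [rho_hk f]. *)
Let pd2_g m x h k : U x ->
  pd k (pd h (g m)) x = pd k (pd h rho) x * f m x + dot h k * w m x.
Proof.
move=> Ux.
pose G y := rho y * pd h (f m) y + f m y * pd h rho y.
have dG : differentiable G x.
  apply: differentiableD; apply: differentiableM;
    by [exact: drho|exact: dfh|exact: dfm|exact: drho1].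
rewrite (@pd_eq _ _ U G _ x k oU _ Ux dG) => [|y Uy]; last by rewrite pd_g.
rewrite pdD; [|exact: differentiableM (drho Ux) (dfh m h Ux)
              |exact: differentiableM (dfm m Ux) (drho1 h Ux)].
rewrite (pdM k (drho Ux) (dfh m h Ux)) (pdM k (dfm m Ux) (drho1 h Ux)).
by rewrite -rho_f2 //; ring.
Qed.

(** Differentiating [(rho f)_hk = rho_hk f] along [l] and [(rho f)_hl = rho_hl f] along [k] gives
    [rho_hk f_l = rho_hl f_k]; pairing with [f_l], which is orthogonal to [f_k], kills the right
    side. *)
Let hessian_orth x h k l : U x -> l != 0 ->
  dot h k = 0 -> dot h l = 0 -> dot k l = 0 -> pd k (pd h rho) x = 0.
Proof.
move=> Ux l0 hk hl kl; have [s0 sx] := sE Ux.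
have smr h' k' : smooth 1 U (pd k' (pd h' rho)) by do 2!apply: smooth_pd.
have dmr h' k' : differentiable (pd k' (pd h' rho)) x by exact: smooth_diff (smr _ _) Ux.
have E m h' k' l' : dot h' k' = 0 ->
    pd l' (pd k' (pd h' (g m))) x =
    pd k' (pd h' rho) x * pd l' (f m) x + f m x * pd l' (pd k' (pd h' rho)) x.
  move=> hk0; rewrite -pdM //; last exact: dfm.
  apply: (pd_eq _ oU _ Ux); last by apply: differentiableM => //; exact: dfm.
  by move=> y Uy; rewrite pd2_g // hk0 mul0r addr0.
have P m : pd k (pd h rho) x * pd l (f m) x = pd l (pd h rho) x * pd k (f m) x.
  have := E m h k l hk; rewrite (pdC _ _ oU (smooth_pd h (smg m)) Ux) E //.
  rewrite (pdC _ _ oU (smooth_pd h smrho) Ux) => /addIr ->.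
  by [].
have : \sum_m pd k (pd h rho) x * pd l (f m) x * pd l (f m) x =
    \sum_m pd l (pd h rho) x * pd k (f m) x * pd l (f m) x.
  by apply: eq_bigr => m _; rewrite P.
under eq_bigr do rewrite -mulrA; under [in RHS]eq_bigr do rewrite -mulrA.
rewrite -!mulr_sumr !sx kl !mulr0 => /eqP.
by rewrite !mulf_eq0 dot_eq0 (negbTE l0) (gt_eqF s0) !orbF => /eqP.
Qed.

(** Supplies the auxiliary direction [l] of [hessian_orth]; here the dimension must exceed two. *)
Let third (i j : 'I_n) : exists k : 'I_n, (k != i) && (k != j).
Proof.
pose o1 : 'I_n := Ordinal (ltnW n2); pose o2 : 'I_n := Ordinal n2.
have : [|| (i0 != i) && (i0 != j), (o1 != i) && (o1 != j) | (o2 != i) && (o2 != j)].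
  rewrite -!val_eqE /=.
  by move: (val i) (val j) => [|[|[|a]]] [|[|[|b]]].
by case/or3P; [exists i0|exists o1|exists o2].
Qed.

Let sig x := pd (e i0) (pd (e i0) rho) x.

Let hessian_rho x h k : U x -> pd k (pd h rho) x = sig x * dot h k.
Proof.
move=> Ux.
have off i j : i != j -> pd (e i) (pd (e j) rho) x = 0.
  move=> ij; have [l /andP[li lj]] := third i j.
  apply: (hessian_orth (l := e l) Ux).
  - by rewrite -dot_eq0 dot_basis eqxx oner_neq0.
  - by rewrite dot_basis eq_sym (negbTE ij).
  - by rewrite dot_basis eq_sym (negbTE lj).
  - by rewrite dot_basis eq_sym (negbTE li).
have lin_h a b c : pd c (pd (a + b) rho) x = pd c (pd a rho) x + pd c (pd b rho) x.
  rewrite (pdC _ _ oU smrho Ux) pdDr.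
  by congr (_ + _); rewrite (pdC _ _ oU smrho Ux).
have lin_N b c : pd c (pd (- b) rho) x = - pd c (pd b rho) x.
  by rewrite (pdC _ _ oU smrho Ux) pdNr (pdC _ _ oU smrho Ux).
have diag i : pd (e i) (pd (e i) rho) x = sig x.
  have [->//|ij] := eqVneq i i0.
  have [l /andP[li lj]] := third i i0.
  (* These two vectors are orthogonal, and the Hessian on the pair is the difference of two diagonal
     entries. *)
  have : pd (e i - e i0) (pd (e i + e i0) rho) x = 0.
    apply: (hessian_orth (l := e l) Ux).
    - by rewrite -dot_eq0 dot_basis eqxx oner_neq0.
    - rewrite !(dotDl, dotDr, dotNr) !dot_basis !eqxx (eq_sym i0) (negbTE ij) /=.
      by ring.
    - by rewrite dotDl !dot_basis ![_ == l]eq_sym (negbTE li) (negbTE lj) addr0.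
    - by rewrite dotDl dotNl !dot_basis ![_ == l]eq_sym (negbTE li) (negbTE lj) subr0.
  rewrite pdDr pdNr !lin_h (off i i0) // (off i0 i) 1?eq_sym // addr0 add0r.
  by move=> /eqP; rewrite subr_eq0 => /eqP.
rewrite (pd2_basis _ _ oU smrho Ux) /dot mulr_sumr; apply: eq_bigr => i _.
rewrite (bigD1 i) //= diag big1 ?addr0 => [|j ji]; last first.
  by rewrite off ?mulr0 // eq_sym.
by rewrite mulrC [k 0 i * _]mulrC.
Qed.

Let sig_const x y : U x -> U y -> sig x = sig y.
Proof.
by apply: (isotropic_hessian_constant (u := rho)) => //; exact: ltnW.
Qed.

Let v_const m x y : U x -> U y -> sig x * f m x + w m x = sig y * f m y + w m y.
Proof.
apply: (isotropic_hessian_constant (u := g m)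
  (tau := fun x => sig x * f m x + w m x)) => //; first exact: ltnW.
by move=> z h k Uz; rewrite pd2_g // hessian_rho //; ring.
Qed.

Let pd_const u : (forall x, U x -> smooth 2 U u) ->
  (forall x h k, U x -> pd k (pd h u) x = 0) ->
  forall h x y, U x -> U y -> pd h u x = pd h u y.
Proof.
move=> su H h x y Ux Uy.
have su1 : smooth 1 U (pd h u) by apply: smooth_pd; exact: su Ux.
apply: (pd0_constant oU cU) => // [z Uz|z k Uz]; first exact: smooth_diff su1 Uz.
exact: H.
Qed.

Let sum_w2 x : U x ->
  \sum_m w m x ^+ 2 = s x * \sum_i pd (e i) rho x ^+ 2.
Proof.
move=> Ux; have [s0 sx] := sE Ux.
pose c : 'rV[R]_n := \row_i pd (e i) rho x.
have wE m : w m x = pd c (f m) x.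
  by rewrite pd_basis; apply: eq_bigr => i _; rewrite mxE.
under eq_bigr do rewrite expr2 !wE.
by rewrite sx; congr (_ * _); apply: eq_bigr => i _; rewrite !mxE.
Qed.

(** Here the gradient [c] of [rho] and the vector [w] are constant, so [|w|^2 = s |c|^2] reads
    [W rho^2 = |c|^2]. Its derivative along [c] is [2 W rho |c|^2 = 0], and either vanishing factor
    forces [c = 0]. So [rho] is constant and the Hessian of [f] is zero. *)
Let affine_case x0 : U x0 -> sig x0 = 0 ->
  exists (A : 'M[R]_n) b, forall x, U x -> forall m, f m x = (x *m A) 0 m + b m.
Proof.
move=> Ux0 sig0.
have sg x : U x -> sig x = 0 by move=> Ux; rewrite (sig_const Ux Ux0).
have Drho h x y : U x -> U y -> pd h rho x = pd h rho y.
  apply: pd_const => [_ _|z k l Uz]; first exact: smooth_le.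
  by rewrite hessian_rho // sg // mul0r.
have w_const m x y : U x -> U y -> w m x = w m y.
  by move=> Ux Uy; have := v_const m Ux Uy; rewrite !sg // !mul0r !add0r.
pose c : 'rV[R]_n := \row_i pd (e i) rho x0.
pose W : R := \sum_m w m x0 ^+ 2.
have c2 : \sum_i pd (e i) rho x0 ^+ 2 = dot c c.
  by apply: eq_bigr => i _; rewrite !mxE.
have WE x : U x -> W * (rho x * rho x) = dot c c.
  move=> Ux; have -> : W = s x * dot c c.
    rewrite /W -c2; under eq_bigr do rewrite (w_const _ _ x Ux0 Ux).
    rewrite sum_w2 //; congr (_ * _); apply: eq_bigr => i _.
    by rewrite (Drho _ x x0).
  by rewrite -[RHS]mul1r -(rho_s Ux); ring.
have cc : dot c c = 0.
  have : pd c (fun x => W * (rho x * rho x)) x0 = pd c (fun=> dot c c) x0.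
    by apply: (pd_eq _ oU _ Ux0) => [y Uy|]; [rewrite WE|exact: differentiable_cst].
  have dr := drho Ux0.
  rewrite pd_cst (pdZ W c (diffMf dr dr)) (pdM c dr dr).
  have -> : pd c rho x0 = dot c c.
    by rewrite pd_basis; apply: eq_bigr => i _; rewrite !mxE.
  move=> /eqP; rewrite -mulr2n -mulr_natr !mulf_eq0 pnatr_eq0 orbF.
  rewrite (gt_eqF (rho_gt0 Ux0)) /= => /orP[/eqP W0|/eqP//].
  by rewrite -(WE x0 Ux0) W0 mul0r.
have Dr0 h x : U x -> pd h rho x = 0.
  move=> Ux; rewrite (Drho h x x0) // pd_basis big1 // => i _.
  move/eqP: cc; rewrite dot_eq0 => /eqP/rowP/(_ i); rewrite !mxE => ->.
  by rewrite mulr0.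
have rc x : U x -> rho x = rho x0.
  move=> Ux; apply: (pd0_constant oU cU _ _ Ux Ux0) => [z Uz|z h Uz].
    exact: drho.
  exact: Dr0.
have w0 m x : U x -> w m x = 0.
  by move=> Ux; rewrite /w big1 // => i _; rewrite Dr0 // mul0r.
have Df m h x : U x -> pd h (f m) x = pd h (f m) x0.
  move=> Ux.
  have E z : U z -> pd h (g m) z = rho x0 * pd h (f m) z.
    by move=> Uz; rewrite pd_g // Dr0 // mulr0 addr0 rc.
  apply: (mulfI (lt0r_neq0 (rho_gt0 Ux0))).
  rewrite -!E //; apply: pd_const => // [_ _|z k l Uz]; first exact: smooth_le.
  by rewrite pd2_g // hessian_rho // sg // w0 // !mul0r mulr0 addr0.
pose A : 'M[R]_n := \matrix_(i, m) pd (e i) (f m) x0.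
have AE x m : (x *m A) 0 m = dot (x - 0) (\row_i A i m).
  by rewrite mxE subr0; apply: eq_bigr => i _; rewrite [in RHS]mxE.
exists A, (fun m => f m x0 - (x0 *m A) 0 m) => x Ux m.
suff : f m x - (x *m A) 0 m = f m x0 - (x0 *m A) 0 m by move=> <-; rewrite addrC subrK.
pose F z := f m z + -1 * dot (z - 0) (\row_i A i m).
suff : F x = F x0 by rewrite /F -!AE !mulN1r.
have dd z := diff_dot_affine 0 (\row_i A i m) z.
apply: (pd0_constant oU cU _ _ Ux Ux0) => [z Uz|z h Uz].
  exact: diffDf (dfm m Uz) (diffZf (-1) (dd z).1).
rewrite (pdD h (dfm m Uz) (diffZf (-1) (dd z).1)) (pdZ _ h (dd z).1).
rewrite (dd z).2 Df // pd_basis.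
rewrite mulN1r; apply/eqP; rewrite subr_eq0; apply/eqP.
by apply: eq_bigr => i _; rewrite !mxE.
Qed.

(** Both [rho] and [L = rho (f - b)] become explicit: [2 rho = t |x - p|^2], and [L] is the
    orthogonal map [(x - p) B]. Then [f = b + L / rho] is the inversion with [c = 2 / t]. *)
Let inversion_case x0 : U x0 -> sig x0 != 0 ->
  exists (p : 'rV[R]_n) (c : R) (B : 'M[R]_n) b,
  [/\ 0 < c, B *m B^T = 1%:M & forall x, U x -> x != p /\
    forall m, f m x = b m + c / dot (x - p) (x - p) * ((x - p) *m B) 0 m].
Proof.
move=> Ux0 sig0; set t := sig x0 in sig0.
have sg x : U x -> sig x = t by move=> Ux; rewrite (sig_const Ux Ux0).
(* The pole is the zero of the gradient of [rho], which is affine in [x] with linear part [t]. *)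
pose p : 'rV[R]_n := x0 - t^-1 *: \row_i pd (e i) rho x0.
have Drho h x : U x -> pd h rho x = t * dot (x - p) h.
  move=> Ux; pose F z := pd h rho z + - t * dot (z - p) h.
  have dd z := diff_dot_affine p h z.
  have F0 : F x = F x0.
    apply: (pd0_constant oU cU _ _ Ux Ux0) => [z Uz|z k Uz].
      exact: diffDf (drho1 h Uz) (diffZf (- t) (dd z).1).
    rewrite (pdD k (drho1 h Uz) (diffZf (- t) (dd z).1)) (pdZ _ k (dd z).1).
    rewrite (dd z).2.
    by rewrite hessian_rho // sg // (dotC h k) mulNr subrr.
  have : F x0 = 0.
    have x0p : x0 - p = t^-1 *: \row_i pd (e i) rho x0.
      by rewrite /p opprB addrC subrK.
    rewrite /F x0p dotZl mulNr mulrA mulfV // mul1r pd_basis.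
    apply/eqP; rewrite subr_eq0; apply/eqP; apply: eq_bigr => i _.
    by rewrite mxE mulrC.
  by rewrite -F0 /F mulNr => /eqP; rewrite subr_eq0 => /eqP.
(* [t b] is the constant value [sig f + w] of [v_const], so that [w = t (b - f)]. *)
pose b m := t^-1 * (t * f m x0 + w m x0).
have wE m x : U x -> w m x = t * (b m - f m x).
  move=> Ux; have := v_const m Ux Ux0; rewrite !sg // => E.
  by rewrite mulrBr /b mulrA mulfV // mul1r -E; ring.
have radial m x : U x -> pd (x - p) (f m) x = b m - f m x.
  move=> Ux; apply: (mulfI sig0); rewrite -wE // /w pd_basis mulr_sumr.
  by apply: eq_bigr => i _; rewrite Drho // [dot _ (e i)]dotC dot_deltal mulrA.
(* Subtracting [b rho] cancels the Hessian of [rho f], because [t f + w - t b = 0]; so [L] has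
   constant derivatives. *)
pose L m x := g m x + - b m * rho x.
have LE m x : L m x = rho x * (f m x - b m) by rewrite /L /g; ring.
have smL m : smooth 3 U (L m).
  by apply: smoothD => //; apply: smoothM => //; exact: smooth_cst.
have dL m x : U x -> differentiable (L m) x by move=> Ux; exact: smooth_diff (smL m) Ux.
have pdL m h x : U x -> pd h (L m) x = pd h (g m) x + - b m * pd h rho x.
  move=> Ux; rewrite (pdD h (smooth_diff (smg m) Ux) (diffZf (- b m) (drho Ux))).
  by rewrite (pdZ _ h (drho Ux)).
have pd2L m h k x : U x -> pd k (pd h (L m)) x = 0.
  move=> Ux; have dg : differentiable (pd h (g m)) x.
    exact: smooth_diff (smooth_pd h (smg m)) Ux.
  have dM := diffZf (- b m) (drho1 h Ux).
  rewrite (@pd_eq _ _ U (fun x => pd h (g m) x + - b m * pd h rho x) _ x k oU _ Ux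
    (diffDf dg dM)); last by move=> y Uy; rewrite pdL.
  rewrite (pdD k dg dM) (pdZ _ k (drho1 h Ux)).
  by rewrite pd2_g // hessian_rho // sg // wE //; ring.
have DL m h x y : U x -> U y -> pd h (L m) x = pd h (L m) y.
  by apply: pd_const => [_ _|z h' k' Uz]; [exact: smooth_le (smL m)|exact: pd2L].
have radialL m x : U x -> pd (x - p) (L m) x =
    (t * dot (x - p) (x - p) - rho x) * (f m x - b m).
  by move=> Ux; rewrite pdL // pd_g // Drho // radial //; ring.
(* By [radial], [L] is [- rho] times the derivative of [f] along [x - p]; conformality and
   [rho^2 s = 1] then give its length. Differentiating this twice shows that the derivative of [L]
   is orthogonal. *)
have L2 x : U x -> \sum_m L m x * L m x = dot (x - p) (x - p).
  move=> Ux; have [s0 sx] := sE Ux.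
  transitivity (rho x ^+ 2 * \sum_m pd (x - p) (f m) x * pd (x - p) (f m) x).
    by rewrite mulr_sumr; apply: eq_bigr => m _; rewrite LE radial //; ring.
  by rewrite sx mulrA rho_s // mul1r.
have LL x h : U x -> \sum_m L m x * pd h (L m) x = dot (x - p) h.
  move=> Ux.
  have sL2 m : smooth 1 U (fun x => L m x * L m x).
    by apply: smoothM => //; do 2!apply: smooth_le.
  have sS := smooth_sum (index_enum 'I_n) oU sL2.
  have : pd h (fun x => dot (x - p) (x - p)) x =
      pd h (fun x => \sum_m L m x * L m x) x.
    by apply: (pd_eq _ oU _ Ux (smooth_diff sS Ux)).
  rewrite (diff_dot_sqr p x).2 (pd_sum _ _ oU Ux sL2).
  under [X in _ = X -> _]eq_bigr do rewrite (pdM h (dL _ _ Ux) (dL _ _ Ux)) -mulr2n -mulr_natl.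
  rewrite -mulr_sumr => E.
  by apply: (mulfI (_ : (2 : R) != 0)); rewrite ?pnatr_eq0 ?E.
have LLL x h k : U x -> \sum_m pd h (L m) x * pd k (L m) x = dot h k.
  move=> Ux.
  have dpL m : differentiable (pd k (L m)) x.
    exact: smooth_diff (smooth_pd k (smL m)) Ux.
  have sM m : smooth 1 U (fun x => L m x * pd k (L m) x).
    apply: smoothM => //; first by do 2!apply: smooth_le.
    by apply: smooth_le; apply: smooth_pd.
  have sS := smooth_sum (index_enum 'I_n) oU sM.
  have : pd h (fun x => dot (x - p) k) x =
      pd h (fun x => \sum_m L m x * pd k (L m) x) x.
    by apply: (pd_eq _ oU _ Ux (smooth_diff sS Ux)) => y Uy; rewrite LL.
  rewrite (diff_dot_affine p k x).2 (pd_sum _ _ oU Ux sM) => ->.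
  apply: eq_bigr => m _; rewrite (pdM h (dL m _ Ux) (dpL m)) pd2L // mulr0 add0r.
  by rewrite mulrC.
(* Compares two values of the product of [L] with its radial derivative: [|x - p|^2] by [LL], and
   [(t |x - p|^2 - rho) / rho] times [|L|^2] by [radialL]. *)
have quad x : U x -> x != p -> 2 * rho x = t * dot (x - p) (x - p).
  move=> Ux xp; have y0 : dot (x - p) (x - p) != 0 by rewrite dot_eq0 subr_eq0.
  have := LL x (x - p) Ux.
  under eq_bigr do rewrite radialL //.
  have E : rho x * \sum_m L m x * ((t * dot (x - p) (x - p) - rho x) * (f m x - b m))
     = (t * dot (x - p) (x - p) - rho x) * dot (x - p) (x - p).
    by rewrite -L2 // !mulr_sumr; apply: eq_bigr => m _; rewrite LE; ring.
  move=> E'; move: E; rewrite E' => /(mulIf y0) E2; lra.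
(* [quad] holds only off [p], which might still lie in [U]. One point other than [p] fixes the
   constant [2 rho - t |x - p|^2]; then [rho > 0] excludes [p] from [U]. *)
have [x1 Ux1 x1p] : exists2 x1, U x1 & x1 != p.
  have [x0p|] := eqVneq x0 p; last by exists x0.
  have /nbhs_ballP[r /= r0 xr] := open_nbhs_nbhs (conj oU Ux0).
  have nz : (r / 2) *: e i0 != 0.
    rewrite -dot_eq0 dotZl dotZr dot_basis eqxx mulr1 mulf_neq0 // gt_eqF //;
      by rewrite divr_gt0.
  exists (p + (r / 2) *: e i0); last by rewrite addrC -subr_eq0 addrK.
  apply: xr; rewrite -ball_normE /= x0p opprD addNKr normrN normrZ.
  rewrite gtr0_norm ?divr_gt0 // -mulrA gtr_pMr // ltr_pdivrMl // mulr1.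
  apply: (@le_lt_trans _ _ 1); last by rewrite ltr1n.
  apply: norm_le_coord => // i; rewrite mxE eqxx /=.
  by case: (i == i0); rewrite ?normr1 ?normr0 // ler01.
have rhoE x : U x -> 2 * rho x = t * dot (x - p) (x - p).
  move=> Ux; pose F z := 2 * rho z + - t * dot (z - p) (z - p).
  have dd z := diff_dot_sqr p z.
  have F0 : F x = F x1.
    apply: (pd0_constant oU cU _ _ Ux Ux1) => [z Uz|z k Uz].
      exact: diffDf (diffZf 2 (drho Uz)) (diffZf (- t) (dd z).1).
    rewrite (pdD k (diffZf 2 (drho Uz)) (diffZf (- t) (dd z).1)).
    rewrite (pdZ _ k (drho Uz)) (pdZ _ k (dd z).1).
    by rewrite (dd z).2 Drho //; ring.
  have : F x1 = 0 by rewrite /F quad // mulNr subrr.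
  by rewrite -F0 /F mulNr => /eqP; rewrite subr_eq0 => /eqP.
have xp x : U x -> x != p.
  move=> Ux; apply/eqP => xp; have := rhoE x Ux.
  rewrite xp subrr dot0l mulr0 => /eqP; rewrite mulf_eq0 pnatr_eq0 /= -xp.
  by rewrite (gt_eqF (rho_gt0 Ux)).
have t0 : 0 < t.
  have : 0 < t * dot (x0 - p) (x0 - p) by rewrite -rhoE // mulr_gt0 // rho_gt0.
  by rewrite pmulr_lgt0 // dot_gt0 subr_eq0 xp.
pose B : 'M[R]_n := \matrix_(i, m) pd (e i) (L m) x0.
exists p, (2 / t), B, b; split; first by rewrite divr_gt0.
  apply/matrixP => i j; rewrite mxE.
  under eq_bigr do rewrite !mxE.
  by rewrite LLL // dot_basis mxE.
move=> x Ux; split=> [|m]; first exact: xp.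
have LB : L m x = ((x - p) *m B) 0 m.
  rewrite mxE; transitivity (pd (x - p) (L m) x).
    by rewrite radialL // -rhoE // LE; ring.
  by rewrite pd_basis; apply: eq_bigr => i _; rewrite [B i m]mxE (DL _ _ x x0).
have D0 : dot (x - p) (x - p) != 0 by rewrite dot_eq0 subr_eq0 xp.
have r0 : rho x != 0 by rewrite gt_eqF // rho_gt0.
rewrite -LB LE; have -> : rho x = t * dot (x - p) (x - p) / 2.
  by rewrite -rhoE //; field.
by field; rewrite D0 sig0.
Qed.

Theorem liouville : U !=set0 ->
  (exists (A : 'M[R]_n) b, forall x, U x -> forall m, f m x = (x *m A) 0 m + b m) \/
  exists (p : 'rV[R]_n) (c : R) (B : 'M[R]_n) b,
  [/\ 0 < c, B *m B^T = 1%:M & forall x, U x -> x != p /\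
    forall m, f m x = b m + c / dot (x - p) (x - p) * ((x - p) *m B) 0 m].
Proof.
move=> [x0 Ux0]; have [s0|s0] := eqVneq (sig x0) 0.
  by left; exact: affine_case s0.
by right; exact: inversion_case s0.
Qed.

End Liouville.

(** * Phrases: linear images and the geometric series *)

Section RowVectors.
Variable R : realType.

Lemma cvg_row n (u : nat -> 'rV[R]_n) (l : 'rV[R]_n) :
  (forall i, (fun k => u k 0 i) @ \oo --> l 0 i) -> u @ \oo --> l.
Proof.
move=> H; apply/cvgrPdist_le => e e0.
have H' i : \forall k \near \oo, `|l 0 i - u k 0 i| <= e.
  by have /cvgrPdist_le := H i; apply.
have : \forall k \near \oo, forall i, `|l 0 i - u k 0 i| <= e.
  exact: filter_forall.
apply: filterS => k Hk; apply: norm_le_coord => [|i]; first exact: ltW.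
by rewrite !mxE; exact: Hk.
Qed.

Lemma cvg_row_coord n (u : nat -> 'rV[R]_n) (l : 'rV[R]_n) i :
  u @ \oo --> l -> (fun k => u k 0 i) @ \oo --> l 0 i.
Proof.
move=> ul; apply/cvgrPdist_le => e e0.
have /cvgrPdist_le/(_ e e0) := ul; apply: filterS => k; apply: le_trans.
by have := le_coord_norm (l - u k) i; rewrite !mxE.
Qed.

Lemma cvg_mulmx n p (u : nat -> 'rV[R]_n) (l : 'rV[R]_n) (A : 'M[R]_(n, p)) :
  u @ \oo --> l -> (fun k => u k *m A) @ \oo --> l *m A.
Proof.
move=> ul; apply: cvg_row => i.
have -> : (fun k => (u k *m A) 0 i) = (fun k => \sum_j u k 0 j * A j i).
  by apply/funext => k; rewrite mxE.
rewrite mxE; apply: cvg_big => [|j _]; last first.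
  by apply: cvgMr_tmp; exact: cvg_row_coord.
exact: add_continuous.
Qed.

Lemma cvg_series_cons (V : normedModType R) (v : nat -> V) l :
  series (fun m => v m.+1) @ \oo --> l -> series v @ \oo --> v 0%N + l.
Proof.
move=> H; rewrite -cvg_shiftS.
have -> : [sequence series v n.+1]_n = (fun n => v 0%N + series (fun m => v m.+1) n).
  apply/funext => n; rewrite !seriesEnat /= big_nat_recl //.
by apply: cvgD => //; exact: cvg_cst.
Qed.

Lemma series_coord n (u : nat -> 'rV[R]_n) i k :
  series u k 0 i = series (fun k => u k 0 i) k.
Proof. by rewrite !seriesEnat /= summxE. Qed.

Lemma pd_coord (V : normedModType R) n (F : V -> 'rV[R]_n) x h i :
  differentiable F x ->
  differentiable (fun y => F y 0 i) x /\
  pd h (fun y => F y 0 i) x = ('d F x h) 0 i.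
Proof.
move=> dF.
have dc : differentiable (fun N : 'rV[R]_n => N 0 i : R) (F x).
  exact: differentiable_coord.
have dFi : differentiable (fun y => F y 0 i) x by exact: (differentiable_comp dF dc).
split=> //; rewrite pdE -!deriveE // derive_mx ?mxE //.
exact: diff_derivable.
Qed.

Lemma diff_row (V : normedModType R) n (F : V -> 'rV[R]_n) x :
  (forall i, differentiable (fun y => F y 0 i) x) -> differentiable F x.
Proof.
move=> dF.
have -> : F = \sum_i (fun y => F y 0 i *: delta_mx 0 i).
  by apply/funext => y; rewrite fct_sumE -row_sum_delta.
by apply: differentiable_sum => i; exact: differentiableZl.
Qed.

End RowVectors.

Section Phrases.
Variables (R : realType) (r : nat).
Hypothesis r3 : (r <= 3)%N.

(** For such words [df/dz~] vanishes term by term and [df/dz] is the whole Frechet derivative. All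
    phrases built for the extension are of this kind. *)
Fixpoint conj_free (w : cd_word R r) : bool :=
  match w with
  | WVar => true
  | WConj => false
  | WCst _ => true
  | WMul u v => conj_free u && conj_free v
  end.

Lemma word_dzb_conj_free w z h : conj_free w -> word_dzb w z h = 0.
Proof.
elim: w => //= u IHu v IHv /andP[/IHu -> /IHv ->].
by rewrite cd_mul0l cd_mul0r addr0.
Qed.

Lemma phrase_diff nu a rho (F : CD R r -> CD R r) :
  (forall n, conj_free (nu n)) -> phrase_cvg nu a rho ->
  (forall z, cd_abs (z - a) < rho ->
    series (fun n => word_eval (nu n) (z - a)) @ \oo --> F z) ->
  forall z, cd_abs (z - a) < rho -> differentiable F z /\
    forall h, series (fun n => word_dz (nu n) (z - a) h) @ \oo --> ('d F z h : CD R r).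
Proof.
move=> cf nuc FE z zr; have nus := phrase_cvg_summable r3 nuc.
have oB := @open_cd_ball R r a rho.
have FiE i y : cd_abs (y - a) < rho -> sw_sum (fun n => sw_of (nu n)) a i y = F y 0 i.
  move=> /FE /(cvg_row_coord (i := i)) /cvg_lim; rewrite /sw_sum => <- //.
  by congr (limn _); apply/funext => k; rewrite series_coord; congr (series _ k);
    apply/funext => n; rewrite sw_eval_of.
have D i := sw_sum_diff r3 i nus zr.
have nz : \forall y \near z, cd_abs (y - a) < rho.
  exact: (open_nbhs_nbhs (conj oB zr)).
have dFi i : differentiable (fun y => F y 0 i) z.
  have [di _] := D i.
  have E : \forall y \near z, sw_sum (fun n => sw_of (nu n)) a i y = F y 0 i.
    by apply: filterS nz => y; exact: FiE.
  by have [] := near_eq_diff E di.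
have dF := diff_row dFi; split => // h; apply: cvg_row => i.
have [_ <-] := pd_coord h i dF.
have [di pi] := D i.
rewrite (pd_near_eq h _ di); last by apply: filterS nz => y; exact: FiE.
rewrite pi /sw_sum.
have -> : (fun k => series (fun n => word_dz (nu n) (z - a) h) k 0 i) =
    series (fun n => sw_eval (sw_der h (sw_of (nu n))) (z - a) 0 i).
  apply/funext => k; rewrite series_coord; congr (series _ k); apply/funext => n.
  by rewrite sw_der_of word_dzb_conj_free // addr0.
have c := sw_summable_cvg r3 (i := i) (sw_summable_der (h := h) nus) zr.
exact: c.
Qed.

Lemma sum_blocks (V : zmodType) (u : nat -> V) K N :
  \sum_(0 <= m < N * K) u m = \sum_(0 <= n < N) \sum_(k < K) u (n * K + k)%N.
Proof.
elim: N => [|N IH]; first by rewrite mul0n !big_nil.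
rewrite big_nat_recr //= -IH mulSn addnC.
rewrite (big_cat_nat (n := (N * K)%N)) ?leq_addr //=; congr (_ + _).
rewrite -{1}[(N * K)%N]add0n big_addn addKn big_mkord.
by apply: eq_bigr => k _; rewrite addnC.
Qed.

(* A linear map is applied to a phrase by replacing each word with a block of
   [K] words. *)
Lemma phrase_linear (A : 'M[R]_(cd_dim r)) b (Y : nat -> cd_word R r) a rho
    (G : CD R r -> CD R r) : (2 <= r)%N ->
  (forall n, conj_free (Y n)) -> phrase_cvg Y a rho ->
  (forall z, cd_abs (z - a) < rho ->
    series (fun n => word_eval (Y n) (z - a)) @ \oo --> G z) ->
  exists nu, [/\ forall n, conj_free (nu n), phrase_cvg nu a rho &
    forall z, cd_abs (z - a) < rho ->
      series (fun n => word_eval (nu n) (z - a)) @ \oo --> b + G z *m A].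
Proof.
move=> r2 cfY Yc YG.
have [K0 [c1 [c2 [c3 [c4 cE]]]]] := linear_words A (introT andP (conj r2 r3)).
(* One slot more than [K0], filled with the zero word, so that blocks have positive length even if
   [K0 = 0]. *)
pose K := K0.+1.
pose T (k : nat) (w : cd_word R r) : cd_word R r :=
  if insub k is Some i then
    WMul (WCst (c1 i)) (WMul (WCst (c2 i)) (WMul (WMul (WCst (c3 i)) w) (WCst (c4 i))))
  else WCst 0.
pose C (k : nat) : R := if insub k is Some i then
  cd_abs (c1 i) * (cd_abs (c2 i) * (cd_abs (c3 i) * cd_abs (c4 i))) else 0.
have C0 k : 0 <= C k.
  by rewrite /C; case: insubP => // *; rewrite !mulr_ge0 ?cd_abs_ge0.
have TC k w z : cd_abs (word_eval (T k w) z) = C k * cd_abs (word_eval w z).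
  rewrite /T /C; case: insubP => [i _ _|_] /=; last by rewrite cd_abs0 mul0r.
  by rewrite !cd_absM //; ring.
have TA w z : \sum_(k < K) word_eval (T k w) z = word_eval w z *m A.
  rewrite /K big_ord_recr /= [X in _ + X](_ : _ = 0) ?addr0 ?cE.
    apply: eq_bigr => i _; rewrite /T.
    by case: insubP => [j _ /val_inj ->//|]; rewrite ltn_ord.
  by rewrite /T; case: insubP => [j|]; rewrite ?ltnn.
pose u m := T (m %% K)%N (Y (m %/ K)%N).
have uE n k (kK : (k < K)%N) : u (n * K + k)%N = T k (Y n).
  by rewrite /u divnMDl // divn_small // addn0 modnMDl modn_small.
have cu z : cd_abs (z - a) < rho -> cvgn (series (fun m => cd_abs (word_eval (u m) (z - a)))).
  move=> zr; have cY := Yc z zr.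
  have [M MP] : exists M, forall N,
      series (fun n => cd_abs (word_eval (Y n) (z - a))) N <= M.
    have /cvg_seq_bounded/bounded_fun_has_ubound[M hM] := cY.
    by exists M => N; apply: hM; exists N.
  apply: nondecreasing_is_cvgn.
    by apply: nondecreasing_series => n _ _; exact: cd_abs_ge0.
  (* [C k] is the factor by which the [k]-th word of a block multiplies the modulus. As the terms
     are nonnegative, a partial sum up to [N] is bounded by the one over [N] whole blocks. *)
  exists ((\sum_(k < K) C k) * M) => _ [N _ <-].
  apply: (@le_trans _ _ (series (fun m => cd_abs (word_eval (u m) (z - a))) (N * K)%N)).
    apply: (@nondecreasing_series _ _ xpredT 0%N) => [n _ _|]; first exact: cd_abs_ge0.
    by rewrite leq_pmulr.
  rewrite seriesEnat /= sum_blocks.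
  apply: (@le_trans _ _ ((\sum_(k < K) C k) *
    series (fun n => cd_abs (word_eval (Y n) (z - a))) N)); last first.
    by apply: ler_wpM2l => //; exact: sumr_ge0.
  rewrite le_eqVlt; apply/orP; left; apply/eqP.
  rewrite seriesEnat /= mulr_sumr; apply: eq_bigr => n _.
  by rewrite mulr_suml; apply: eq_bigr => k _; rewrite uE // TC.
exists (fun n => if n is m.+1 then u m else WCst b); split.
- case=> [//|m]; rewrite /u /T; case: insubP => [i _ _|//] /=.
  by rewrite cfY.
- move=> z zr; have /cvg_ex[l Hl] := cu z zr.
  apply/cvg_ex; exists (cd_abs b + l).
  exact: (@cvg_series_cons R R^o (fun n => cd_abs (word_eval
    (if n is m.+1 then u m else WCst b) (z - a)))).
move=> z zr.
apply: (@cvg_series_cons R _ (fun n => word_eval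
    (if n is m.+1 then u m else WCst b) (z - a))).
have SE N : series (fun m => word_eval (u m) (z - a)) (N * K)%N =
    series (fun n => word_eval (Y n) (z - a)) N *m A.
  rewrite !seriesEnat /= sum_blocks mulmx_suml; apply: eq_bigr => n _.
  by rewrite -TA; apply: eq_bigr => k _; rewrite uE.
apply: cvg_row => i.
have ci : cvgn (series (fun m => word_eval (u m) (z - a) 0 i)).
  apply: (proj1 (@series_dominated _ _ (fun m => cd_abs (word_eval (u m) (z - a))) _ (cu z zr))).
  by move=> m; exact: le_coord_cd_abs.
have -> : (fun k => series (fun m => word_eval (u m) (z - a)) k 0 i) =
    series (fun m => word_eval (u m) (z - a) 0 i).
  by apply/funext => k; rewrite series_coord.
suff <- : limn (series (fun m => word_eval (u m) (z - a) 0 i)) = (G z *m A) 0 i by [].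
(* The limit is identified along partial sums over whole blocks, which are the images under [A] of
   the partial sums of [Y]. *)
have sub : (fun N => series (fun m => word_eval (u m) (z - a) 0 i) (N * K)%N) @ \oo -->
    limn (series (fun m => word_eval (u m) (z - a) 0 i)).
  exact: (cvg_comp _ _ (@cvg_mulnr K isT) ci).
apply: (cvg_unique _ sub) => /=; first exact: norm_hausdorff.
have -> : (fun N => series (fun m => word_eval (u m) (z - a) 0 i) (N * K)%N) =
    (fun N => (series (fun n => word_eval (Y n) (z - a)) N *m A) 0 i).
  by apply/funext => N; rewrite -SE series_coord.
by apply: cvg_row_coord; apply: cvg_mulmx; exact: YG.
Qed.

Definition cd_inv (q : CD R r) : CD R r := (dot q q)^-1 *: cd_conj q.

(* The word [(- q^-1) (w ((- q^-1) (w (.. q^-1))))]: the sum of these words is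
   [(q + w)^-1] even without associativity, since [q y' = - (w y)] for
   consecutive terms [y], [y']. *)
Fixpoint inv_word (q : CD R r) (n : nat) : cd_word R r :=
  if n is m.+1 then
    WMul (WCst (- cd_inv q)) (WMul (WVar _ _) (inv_word q m))
  else WCst (cd_inv q).

Lemma cd_mulVK (q x : CD R r) : q != 0 -> cd_mul q (cd_mul (cd_inv q) x) = x.
Proof.
rewrite -dot_eq0 => q0; rewrite cd_mulZl cd_mulZr.
have := cd_mulKl (cd_conj q) x r3; rewrite cd_conjK dot_conj => ->.
by rewrite scalerA mulVf // scale1r.
Qed.

Lemma cd_mulKV (q x : CD R r) : q != 0 -> cd_mul (cd_inv q) (cd_mul q x) = x.
Proof.
by rewrite -dot_eq0 => q0; rewrite cd_mulZl cd_mulKl // scalerA mulVf // scale1r.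
Qed.

Lemma cd_abs_inv (q : CD R r) : cd_abs (cd_inv q) = (cd_abs q)^-1.
Proof.
have [->|q0] := eqVneq q 0.
  by rewrite /cd_inv cd_conj0 scaler0 cd_abs0 invr0.
have a0 : cd_abs q != 0 by rewrite cd_abs_eq0.
rewrite cd_absZ cd_abs_conj -sqr_cd_abs ger0_norm ?invr_ge0 ?sqr_ge0 //.
by field.
Qed.

Lemma abs_inv_word q w n :
  cd_abs (word_eval (inv_word q n) w) = (cd_abs q)^-1 * (cd_abs w / cd_abs q) ^+ n.
Proof.
elim: n => [|n IH]; first by rewrite expr0 mulr1 /= cd_abs_inv.
by rewrite /= !cd_absM // IH cd_absN cd_abs_inv exprS; ring.
Qed.

Lemma phrase_cvg_inv q a : q != 0 -> phrase_cvg (inv_word q) a (cd_abs q).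
Proof.
move=> q0 z zq.
have -> : (fun n => cd_abs (word_eval (inv_word q n) (z - a))) =
    geometric (cd_abs q)^-1 (cd_abs (z - a) / cd_abs q).
  by apply/funext => n; rewrite abs_inv_word.
apply: is_cvg_geometric_series.
rewrite ger0_norm ?divr_ge0 ?cd_abs_ge0 // ltr_pdivrMr ?mul1r //.
by rewrite cd_abs_gt0.
Qed.

(** With [w = z - a], multiplying a partial sum by [q + w] telescopes to [1 + w y_n], where [y_n] is
    its last term and tends to [0]. The factor [q + w] is then cancelled on the left by
    [cd_mulKV]. *)
Lemma series_inv_word q a z : q != 0 -> cd_abs (z - a) < cd_abs q ->
  series (fun n => word_eval (inv_word q n) (z - a)) @ \oo --> cd_inv (q + (z - a)).
Proof.
move=> q0; move: (z - a) => w wq; set S := series _.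
pose y n := word_eval (inv_word q n) w.
have x0 : q + w != 0.
  apply: contraTneq wq => /eqP; rewrite addr_eq0 => /eqP ->.
  by rewrite cd_absN ltxx.
have T n : cd_mul (q + w) (S n.+1) = cd_one R r + cd_mul w (y n).
  elim: n => [|n IH].
    rewrite /S seriesEnat /= big_nat1 cd_mulDl /=; congr (_ + _).
    by rewrite -[RHS](cd_mulVK (cd_one R r) q0) (cd_mul1 _).1.
  rewrite /S seriesSr cd_mulDr -/S IH -/(y n.+1) cd_mulDl.
  have -> : cd_mul q (y n.+1) = - cd_mul w (y n).
    by rewrite /y /= cd_mulNl cd_mulNr cd_mulVK.
  by rewrite addrA addrK.
have SE n : S n.+1 = cd_inv (q + w) + cd_mul (cd_inv (q + w)) (cd_mul w (y n)).
  by rewrite -[LHS](cd_mulKV _ x0) T cd_mulDr (cd_mul1 _).1.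
suff cc : (fun n => cd_mul (cd_inv (q + w)) (cd_mul w (y n))) @ \oo -->
    (0 : CD R r).
  rewrite -cvg_shiftS.
  have -> : [sequence S n.+1]_n =
    (fun n => cd_inv (q + w) + cd_mul (cd_inv (q + w)) (cd_mul w (y n))).
    by apply/funext => n; rewrite /= SE.
  have := cvgD (@cvg_cst _ (cd_inv (q + w)) _ \oo _) cc; rewrite addr0; exact.
have y0 : (fun n => cd_abs (y n)) @ \oo --> (0 : R).
  apply: cvg_series_cvg_0; have := @phrase_cvg_inv q 0 q0 w.
  by rewrite subr0; apply.
apply/cvgr0Pnorm_le => e e0.
pose C := cd_abs (cd_inv (q + w)) * cd_abs w.
have C0 : 0 <= C by rewrite mulr_ge0 // cd_abs_ge0.
have /cvgr0Pnorm_le/(_ (e / (C + 1))) : (fun n => cd_abs (y n)) @ \oo --> (0 : R) := y0.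
rewrite divr_gt0 ?ltr_wpDl // => /(_ isT); apply: filterS => n.
rewrite ger0_norm ?cd_abs_ge0 // ler_pdivlMr ?ltr_wpDl // => H.
apply: le_trans (le_norm_cd_abs _) _; rewrite !cd_absM // mulrA -/C.
apply: le_trans H; rewrite mulrC ler_wpM2l ?cd_abs_ge0 // lerDl //.
Qed.

End Phrases.

(** * Similarities and inversions *)

Section Similarities.
Variable R : realType.

Lemma dot_orthogonal n (B : 'M[R]_n) (x y : 'rV[R]_n) : B *m B^T = 1%:M ->
  dot (x *m B) (y *m B) = dot x y.
Proof.
by move=> BB; rewrite !dot_mulmx trmx_mul mulmxA -[x *m B *m _]mulmxA BB mulmx1.
Qed.

(** Unipotent block matrices on both sides move the rank-one term from the upper left block to the
    lower right block of size one. *)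
Lemma det_addr_mul n (u : 'cV[R]_n) (v : 'rV[R]_n) :
  \det (1%:M + u *m v) = 1 + (v *m u) 0 0.
Proof.
pose I : 'M[R]_1 := 1%:M; pose Z : 'cV[R]_n := 0.
have E : (block_mx 1%:M Z v I) *m (block_mx (1%:M + u *m v) u 0 I) *m
    (block_mx 1%:M Z (- v) I) = block_mx 1%:M u 0 (I + v *m u).
  rewrite !mulmx_block /I /Z !(mul1mx, mulmx1, mul0mx, mulmx0, addr0, add0r).
  rewrite !mulmxN mulmxDl mul1mx mulmxDr mulmx1; congr block_mx.
  - by rewrite addrK.
  - by rewrite mulmxA [X in _ - X]addrC subrr.
  - by rewrite addrC.
have := congr1 determinant E.
rewrite !det_mulmx !det_lblock !det_ublock !det1 !mul1r !mulr1 => ->.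
by rewrite det_mx11 !mxE.
Qed.

(** Acting on rows, this is the reflection in the hyperplane orthogonal to [y]. The rank-one form is
    the one that [det_addr_mul] handles. *)
Definition reflection_mx n (y : 'rV[R]_n) : 'M[R]_n :=
  1%:M + (- (2 / dot y y) *: y^T) *m y.

Lemma mul_reflection n (y h : 'rV[R]_n) :
  h *m reflection_mx y = h - (2 * dot h y / dot y y) *: y.
Proof.
rewrite mulmxDr mulmx1 -scalemxAl -scalemxAr mulmxA.
rewrite [h *m y^T]mx11_scalar -dot_mulmx mul_scalar_mx scalerA.
by rewrite -[X in _ = _ + X]scaleNr; congr (_ + _ *: _); ring.
Qed.

Lemma det_reflection n (y : 'rV[R]_n) : y != 0 -> \det (reflection_mx y) = -1.
Proof.
rewrite -dot_eq0 => y0; rewrite det_addr_mul -scalemxAr mxE -dot_mulmx.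
by field.
Qed.

Lemma dot_reflection n (y h k : 'rV[R]_n) : y != 0 ->
  dot (h *m reflection_mx y) (k *m reflection_mx y) = dot h k.
Proof.
rewrite -dot_eq0 => y0; rewrite !mul_reflection.
rewrite !(dotDl, dotDr, dotNl, dotNr, dotZl, dotZr) (dotC y k).
by field.
Qed.

(** Basis vectors must have images of equal length: [e_i + e_0] and [e_i - e_0] are orthogonal, and
    their images are orthogonal only if [|L e_i| = |L e_0|]. *)
Lemma orthogonal_images n (L : {linear 'rV[R]_n -> 'rV[R]_n}) : (0 < n)%N ->
  (forall h k, h != 0 -> k != 0 -> dot h k = 0 -> dot (L h) (L k) = 0) ->
  (exists h, L h != 0) ->
  exists2 s, 0 < s & forall h k, dot (L h) (L k) = s * dot h k.
Proof.
move=> n0 orth [h0 Lh0]; pose e i : 'rV[R]_n := delta_mx 0 i.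
have e0 i : e i != 0 by rewrite -dot_eq0 dot_basis eqxx oner_neq0.
pose i0 := Ordinal n0; pose s := dot (L (e i0)) (L (e i0)).
have off i j : i != j -> dot (L (e i)) (L (e j)) = 0.
  by move=> ij; apply: orth; rewrite ?e0 // dot_basis (negbTE ij).
have diag i : dot (L (e i)) (L (e i)) = s.
  have [->//|ii] := eqVneq i i0.
  have ne (a : R) : a != 0 -> e i + a *: e i0 != 0.
    move=> a0; apply/eqP => /rowP/(_ i0); rewrite !mxE !eqxx /= eq_sym (negbTE ii).
    by rewrite add0r mulr1 => /eqP; rewrite (negbTE a0).
  have : dot (L (e i + 1 *: e i0)) (L (e i + (-1) *: e i0)) = 0.
    apply: orth; rewrite ?ne ?oppr_eq0 ?oner_neq0 //.
    rewrite !(dotDl, dotDr, dotZl, dotZr) !dot_basis !eqxx (eq_sym i0) (negbTE ii).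
    by rewrite /=; ring.
  rewrite !linearD !linearZ !(dotDl, dotDr, dotZl, dotZr).
  rewrite (off i i0) // (off i0 i) 1?eq_sym // => /eqP E.
  by apply/eqP; rewrite -subr_eq0 -/s; rewrite -(eqP E) -/s; apply/eqP; ring.
have LE h k : dot (L h) (L k) = s * dot h k.
  have Lsum x : L x = \sum_i x 0 i *: L (e i).
    by rewrite {1}[x]row_sum_delta linear_sum; apply: eq_bigr => i _; rewrite linearZ.
  have dsl (F : 'I_n -> 'rV[R]_n) z : dot (\sum_i F i) z = \sum_i dot (F i) z.
    by elim/big_rec2: _ => [|i a b _ <-]; rewrite ?dot0l ?dotDl.
  rewrite (Lsum h) dsl /dot mulr_sumr; apply: eq_bigr => i _.
  rewrite -/(dot _ _) dotZl dotC (Lsum k) dsl (bigD1 i) //= dotZl diag big1 => [|j ji].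
    by rewrite addr0; ring.
  by rewrite dotZl off ?mulr0.
exists s => //.
have s0 : 0 <= s by exact: dot_ge0.
rewrite lt_def s0 andbT; apply: contraNneq Lh0 => sE.
by rewrite -dot_eq0 LE sE mul0r.
Qed.

End Similarities.

(** * Pseudoconformality and its explicit models *)

HB.lock Definition cd_diff (R : realType) (r : nat) (F : CD R r -> CD R r)
  (z h : CD R r) : CD R r := 'd F z h.

Section Pseudoconformal.
Variables (R : realType) (r : nat).

Lemma cd_diffE (F : CD R r -> CD R r) z h : cd_diff F z h = 'd F z h.
Proof. by rewrite cd_diff.unlock. Qed.

Lemma cd_diff_coord (F : CD R r -> CD R r) z h i : differentiable F z ->
  differentiable (fun y => F y 0 i) z /\
  pd h (fun y => F y 0 i) z = cd_diff F z h 0 i.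
Proof. by move=> dF; rewrite cd_diffE; exact: pd_coord. Qed.

(** The angle condition at orthogonal [h], [k], divided by [|h| |k|], says that orthogonality is
    preserved. *)
Lemma pseudoconformal_similarity (L : {linear CD R r -> CD R r}) dzb :
  pseudoconformal_at L dzb ->
  exists2 s, 0 < s & forall h k, dot (L h) (L k) = s * dot h k.
Proof.
move=> [_ conf nz _]; apply: orthogonal_images => // [|h k h0 k0 hk].
  by elim: (r) => //= r' IH; rewrite addn_gt0 IH.
have := conf h k; rewrite !cd_re_dot hk mulr0 => /eqP.
by rewrite !mulf_eq0 !cd_abs_eq0 (negbTE h0) (negbTE k0) !orbF => /eqP.
Qed.

Lemma similarity_pseudoconformal (L dzb : CD R r -> CD R r) s : 0 < s ->
  (forall h k, dot (L h) (L k) = s * dot h k) -> (forall h, dzb h = 0) ->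
  0 < \det (lin1_mx L) -> pseudoconformal_at L dzb.
Proof.
move=> s0 LE dzb0 dL; split=> // [h k|].
  have aL x : cd_abs (L x) = Num.sqrt s * cd_abs x.
    by rewrite !cd_absE LE sqrtrM // ltW.
  rewrite !cd_re_dot LE !aL -{1}(sqr_sqrtr (ltW s0)); ring.
exists (cd_one R r); rewrite -dot_eq0 LE dot_one mulr1; exact: lt0r_neq0.
Qed.

Lemma phrase_superderivatives (G : set (CD R r)) (F : CD R r -> CD R r) :
  (r <= 3)%N ->
  (forall xi, G xi -> exists nu a rho, [/\ cd_abs (xi - a) < rho,
     forall n, conj_free (nu n), phrase_cvg nu a rho &
     forall z, cd_abs (z - a) < rho ->
       series (fun n => word_eval (nu n) (z - a)) @ \oo --> F z]) ->
  superderivatives G F (cd_diff F) (fun _ _ => 0).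
Proof.
move=> r3 H; split=> xi Gxi; have [nu [a [rho [ar cf nuc FE]]]] := H xi Gxi; last first.
  by have [dF _] := phrase_diff r3 cf nuc FE ar; split => // h; rewrite addr0 cd_diffE.
exists nu, a, rho; split=> //.
have oB : open [set z : CD R r | cd_abs (z - a) < rho] by exact: open_cd_ball.
have nB : \forall z \near xi, cd_abs (z - a) < rho := open_nbhs_nbhs (conj oB ar).
apply: filterS nB => z zr.
split; first exact: FE.
have [_ dF] := phrase_diff r3 cf nuc FE zr.
move=> h; split; first by rewrite cd_diffE; exact: dF.
have -> : series (fun n => word_dzb (nu n) (z - a) h) = (fun=> 0).
  apply/funext => k; rewrite seriesEnat /= big1 // => n _.
  exact: word_dzb_conj_free.
exact: cvg_cst.
Qed.

Lemma superderivatives_smooth (U : set (CD R r)) f dz dzb m n : (r <= 3)%N ->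
  open U -> superderivatives U f dz dzb -> smooth n U (fun x => f x 0 m).
Proof.
move=> r3 oU [H _]; apply: smooth_local => xi Uxi.
have [nu [a [rho [ar nuc]]]] := H xi Uxi.
have oB : open [set z : CD R r | cd_abs (z - a) < rho] by exact: open_cd_ball.
move=> /(filterI (open_nbhs_nbhs (conj oB ar))).
rewrite nbhsE => -[W [oW Wxi] WE].
exists W => //.
have sW : smooth n W (sw_sum (fun n => sw_of (nu n)) a m).
  have sB := @smooth_sw_sum R r r3 n (fun n => sw_of (nu n)) a rho m
    (phrase_cvg_summable r3 nuc).
  apply: smooth_subset sB.
  by move=> z /WE[].
apply: smooth_ext sW => // z /WE[_ /= [/(cvg_row_coord (i := m)) /cvg_lim <- // _]].
rewrite /sw_sum; congr (limn _); apply/funext => k; rewrite series_coord.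
by congr (series _ k); apply/funext => j; rewrite sw_eval_of.
Qed.

End Pseudoconformal.

Section Inversions.
Variables (R : realType) (r : nat) (p b : CD R r) (c : R) (B : 'M[R]_(cd_dim r)).
Hypotheses (r23 : (2 <= r <= 3)%N) (c0 : 0 < c) (BB : B *m B^T = 1%:M).

Definition inversion (z : CD R r) : CD R r :=
  b + (c / dot (z - p) (z - p)) *: ((z - p) *m B).

Lemma inversionE z m : inversion z 0 m =
  b 0 m + c / dot (z - p) (z - p) * ((z - p) *m B) 0 m.
Proof. by rewrite mxE; congr (_ + _); rewrite mxE. Qed.

Lemma open_punctured : open [set z : CD R r | z != p].
Proof.
have -> : [set z : CD R r | z != p] = ~` [set p].
  by apply/seteqP; split => z /= /eqP.
by apply/closed_openC/accessible_closed_set1/hausdorff_accessible/norm_hausdorff.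
Qed.

(** [y / |y|^2] is the conjugate of [y^-1], so the map is an affine image of [(z - p)^-1], with
    conjugation absorbed into the matrix. The inverse is expanded about each point [xi] itself, up
    to the distance of the pole. *)
Lemma inversion_superderivatives :
  superderivatives [set z | z != p] inversion (cd_diff inversion) (fun _ _ => 0).
Proof.
have /andP[r2 r3] := r23.
apply: phrase_superderivatives => // xi /= xip.
have q0 : xi - p != 0 by rewrite subr_eq0.
pose J : {linear CD R r -> CD R r} :=
  HB.pack (@cd_conj R r) (GRing.isLinear.Build _ _ _ _ (@cd_conj R r)
    (fun k (x y : CD R r) => etrans (cd_conjD _ _) (congr1 (+%R^~ _) (cd_conjZ k x)))).
have cf n : conj_free (inv_word (xi - p) n) by elim: n.
have S z : cd_abs (z - xi) < cd_abs (xi - p) ->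
    series (fun n => word_eval (inv_word (xi - p) n) (z - xi)) @ \oo --> cd_inv (z - p).
  move=> zr; have := series_inv_word r3 q0 zr.
  by rewrite [xi - p + _]addrC addrA subrK.
have [nu [nucf nuc nuE]] := phrase_linear r3 (c *: (lin1_mx J *m B)) b r2 cf
  (phrase_cvg_inv r3 (a := xi) q0) S.
exists nu, xi, (cd_abs (xi - p)); split => //.
  by rewrite subrr cd_abs0 cd_abs_gt0.
move=> z zr; have := nuE z zr.
suff -> : b + cd_inv (z - p) *m (c *: (lin1_mx J *m B)) = inversion z by [].
rewrite /inversion; congr (_ + _).
rewrite -scalemxAr mulmxA mul_rV_lin1 /= /cd_inv cd_conjZ cd_conjK.
by rewrite -scalemxAl scalerA.
Qed.

Lemma inversion_differentiable z : z != p -> differentiable inversion z.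
Proof. by move=> zp; have [_ /(_ z zp)[]] := inversion_superderivatives. Qed.

(** Differentiating [|x - p|^2 (f - b) = c (x - p) B], with [f] the inversion, avoids the derivative
    of a quotient; the resulting equation is solved for the unknown derivative. *)
Lemma diff_inversion z h : z != p ->
  cd_diff inversion z h = (c / dot (z - p) (z - p)) *: (h *m reflection_mx (z - p) *m B).
Proof.
move=> zp; apply/rowP => m.
have dI := inversion_differentiable zp.
have [dm <-] := cd_diff_coord h m dI.
have D0 : dot (z - p) (z - p) != 0 by rewrite dot_eq0 subr_eq0.
pose col : CD R r := \row_i B i m.
have mulB x : (x *m B) 0 m = dot x col.
  by rewrite mxE; apply: eq_bigr => i _; rewrite [col _ _]mxE.
have [d1 D1] := diff_dot_sqr p z; have [d2 D2] := diff_dot_affine p col z.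
have db : differentiable (fun=> - b 0 m : R) z by exact: (@differentiable_cst R _ R^o).
have E x : x != p -> dot (x - p) (x - p) * (inversion x 0 m + - b 0 m) =
    c * dot (x - p) col.
  move=> xp; have X0 : dot (x - p) (x - p) != 0 by rewrite dot_eq0 subr_eq0.
  by rewrite inversionE mulB; field.
have dM := diffMf d1 (diffDf dm db).
have EX := pd_eq h open_punctured E zp dM.
rewrite (pdZ c h d2) D2 (pdM h d1 (diffDf dm db)) (pdD h dm db) pd_cst addr0 D1 in EX.
have IE : inversion z 0 m + - b 0 m = c / dot (z - p) (z - p) * dot (z - p) col.
  by rewrite inversionE mulB; ring.
rewrite IE (dotC (z - p) h) in EX.
rewrite [RHS]mxE mulB mul_reflection.
move: EX D0; set X := pd _ _ _; move: (z - p) => y EX D0.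
rewrite dotDl dotNl dotZl; move: EX D0; set D := dot y y => EX D0.
apply: (mulfI D0).
have -> : D * X = c * dot h col - c / D * dot y col * (2 * dot h y).
  by rewrite EX addrK.
by field.
Qed.

Lemma dot_diff_inversion z h k : z != p ->
  dot (cd_diff inversion z h) (cd_diff inversion z k) =
  (c / dot (z - p) (z - p)) ^+ 2 * dot h k.
Proof.
move=> zp; rewrite !diff_inversion // dotZl dotZr dot_orthogonal //.
by rewrite dot_reflection ?subr_eq0 // mulrA -expr2.
Qed.

Lemma det_diff_inversion z : z != p ->
  \det (lin1_mx (cd_diff inversion z)) =
  - ((c / dot (z - p) (z - p)) ^+ cd_dim r * \det B).
Proof.
move=> zp.
have -> : lin1_mx (cd_diff inversion z) =
    (c / dot (z - p) (z - p)) *: (reflection_mx (z - p) *m B).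
  apply/matrixP => i j; rewrite mxE diff_inversion // !mxE -rowE.
  by congr (_ * _); apply: eq_bigr => k _; rewrite [row _ _ _ _]mxE.
by rewrite detZ det_mulmx det_reflection ?subr_eq0 //; ring.
Qed.

(** The reflection in the derivative reverses orientation, so [B] has to reverse it once more. *)
Lemma inversion_pseudoconformal : \det B < 0 ->
  pseudoconformal [set z | z != p] inversion (cd_diff inversion).
Proof.
move=> dB; exists (fun _ _ => 0); first exact: inversion_superderivatives.
move=> z /= zp; have D0 : 0 < c / dot (z - p) (z - p).
  by rewrite divr_gt0 // dot_gt0 subr_eq0.
apply: (similarity_pseudoconformal (s := (c / dot (z - p) (z - p)) ^+ 2)) => //.
- by rewrite exprn_gt0.
- by move=> h k; exact: dot_diff_inversion.
by rewrite det_diff_inversion // oppr_gt0 pmulr_rlt0 // exprn_gt0.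
Qed.

End Inversions.

(** * Extension to a domain around [U] and [S] *)

Lemma connected_ball (R : realType) (V : normedModType R) (x : V) (e : R) :
  0 < e -> connected (ball x e).
Proof.
move=> e0; pose A (y : V) := [set x + t *: (y - x) | t in `[0, 1] : set R].
have -> : ball x e = \bigcup_(y in ball x e) A y.
  apply/seteqP; split => [y xy|_ [y xy [t t01 <-]]].
    exists y => //; exists 1; first by rewrite /= in_itv /= ler01 lexx.
    by rewrite scale1r addrC subrK.
  apply: segment_ball; first by move: t01; rewrite /= in_itv.
  by move: xy; rewrite -ball_normE /= distrC.
apply: bigcup_connected.
  exists x => y _; exists 0; first by rewrite /= in_itv /= ler01 lexx.
  by rewrite scale0r addr0.
move=> y _; apply: connected_continuous_connected; first exact: segment_connected.
apply: continuous_subspaceT => t; apply: cvgD; first exact: cvg_cst.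
by apply: cvgZr_tmp; exact: cvg_id.
Qed.

(** A ball centred in the closure of [U] meets [U], so its union with [U] is connected, and all
    these unions share [U]. An extension to any open set around [U] and [S] thus yields one to a
    domain. *)
Lemma connected_thickening (R : realType) (V : normedModType R) (U S G : set V) :
  open U -> connected U -> U !=set0 -> S `<=` closure U -> open G ->
  U `|` S `<=` G ->
  exists W, [/\ open W, connected W, W !=set0, U `|` S `<=` W & W `<=` G].
Proof.
move=> oU cU [x0 Ux0] SU oG USG.
pose P : set (V * R) := [set q | (U `|` S) q.1 /\ 0 < q.2 /\ ball q.1 q.2 `<=` G].
have inP x : (U `|` S) x -> exists2 q, P q & ball q.1 q.2 x.
  move=> USx; have /nbhs_ballP[e e0 xe] := open_nbhs_nbhs (conj oG (USG x USx)).
  by exists (x, e) => //; exact: ballxx.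
exists (\bigcup_(q in P) (U `|` ball q.1 q.2)); split.
- apply: bigcup_open => -[x e] [/= _ [e0 _]]; apply: openU => //.
  exact: ball_open.
- apply: bigcup_connected; first by exists x0 => q _; left.
  move=> [x e] [/= USx [e0 _]]; apply: connectedU => //; last exact: connected_ball.
  have : closure U x by case: USx => [Ux|/SU//]; exact: subset_closure.
  by move=> /(_ _ (nbhsx_ballx x e e0)).
- by have [q Pq xq] := inP x0 (or_introl Ux0); exists x0; exists q => //; left.
- by move=> x /inP[q Pq xq]; exists q => //; right.
- move=> x [q [_ [_ qG]] [Ux|/qG//]]; apply: USG; by left.
Qed.

Lemma superderivatives_subset (R : realType) r (U W : set (CD R r)) f dz dzb :
  W `<=` U -> superderivatives U f dz dzb -> superderivatives W f dz dzb.
Proof. by move=> WU [H1 H2]; split=> xi /WU; [exact: H1|exact: H2]. Qed.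

Lemma pseudoconformal_subset (R : realType) r (U W : set (CD R r)) f f' :
  W `<=` U -> pseudoconformal U f f' -> pseudoconformal W f f'.
Proof.
move=> WU [dzb sf pf]; exists dzb; first exact: superderivatives_subset sf.
by move=> xi /WU; exact: pf.
Qed.

Section PseudoconformalFunctions.
Variables (R : realType) (r : nat) (U : set (CD R r)) (f : CD R r -> CD R r).
Variable f' : CD R r -> CD R r -> CD R r.
Hypotheses (r23 : (2 <= r <= 3)%N) (oU : open U) (cU : connected U).
Hypotheses (U0 : U !=set0) (pf : pseudoconformal U f f').

Lemma pseudoconformal_diff z : U z ->
  differentiable f z /\ f' z = cd_diff f z.
Proof.
move=> Uz; have [dzb [_ H] pc] := pf.
have [df dfE] := H z Uz; have [dzb0 _ _ _] := pc z Uz.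
by split => //; apply/funext => h; rewrite cd_diffE dfE dzb0 addr0.
Qed.

Lemma pseudoconformal_diff_similarity z : U z ->
  exists2 s, 0 < s & forall h k,
    dot (cd_diff f z h) (cd_diff f z k) = s * dot h k.
Proof.
move=> Uz; have [df fE] := pseudoconformal_diff Uz.
have [dzb _ /(_ z Uz)] := pf; rewrite fE cd_diff.unlock.
exact: (@pseudoconformal_similarity R r ('d f z)).
Qed.

Lemma pseudoconformal_det z : U z -> 0 < \det (lin1_mx (f' z)).
Proof. by move=> Uz; have [dzb _ /(_ z Uz)[]] := pf. Qed.

Lemma pseudoconformal_moebius :
  (exists (A : 'M[R]_(cd_dim r)) b, forall z, U z -> f z = b + z *m A) \/
  exists p b (c : R) B, [/\ 0 < c, B *m B^T = 1%:M &
    forall z, U z -> z != p /\ f z = inversion p b c B z].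
Proof.
have /andP[r2 r3] := r23.
have n2 : (2 < cd_dim r)%N.
  by move: r2 r3; case: (r) => [|[|[|[|]]]].
have smf m : smooth 4 U (fun x => f x 0 m).
  by have [dzb sf _] := pf; exact: superderivatives_smooth sf.
have conf x : U x -> exists2 s, 0 < s & forall h k,
    \sum_m pd h (fun x => f x 0 m) x * pd k (fun x => f x 0 m) x = s * dot h k.
  move=> Ux; have [s s0 H] := pseudoconformal_diff_similarity Ux.
  have [df _] := pseudoconformal_diff Ux.
  exists s => // h k; rewrite -H; apply: eq_bigr => m _.
  by rewrite (cd_diff_coord h m df).2 (cd_diff_coord k m df).2.
have [[A [b H]]|[p [c [B [b [c0 BB H]]]]]] := liouville n2 oU cU smf conf U0.
  left; exists A, (\row_m b m) => z Uz; apply/rowP => m.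
  by rewrite H // addrC !mxE.
right; exists p, (\row_m b m), c, B; split => // z Uz.
have [zp HE] := H z Uz; split => //; apply/rowP => m.
by rewrite HE inversionE !mxE.
Qed.

Lemma diff_eq_on (g : CD R r -> CD R r) z : (forall y, U y -> f y = g y) ->
  U z -> differentiable g z -> f' z = cd_diff g z.
Proof.
move=> fg Uz dg; have [df ->] := pseudoconformal_diff Uz.
apply/funext => h; apply/rowP => m.
have [d1 <-] := cd_diff_coord h m df; have [_ <-] := cd_diff_coord h m dg.
by apply/esym; apply: (pd_eq h oU _ Uz d1) => y Uy; rewrite fg.
Qed.

End PseudoconformalFunctions.

Lemma affine_superderivatives (R : realType) r (A : 'M[R]_(cd_dim r)) b :
  (2 <= r <= 3)%N ->
  superderivatives setT (fun z => b + z *m A)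
    (cd_diff (fun z : CD R r => b + z *m A)) (fun _ _ => 0).
Proof.
move=> /andP[r2 r3]; apply: phrase_superderivatives => // xi _.
(* A single word, the variable [z - xi], padded with zeros; [b + z A] is its image under [A] plus
   the constant [b + xi A]. *)
pose Y (n : nat) : cd_word R r := if n is 0%N then WVar _ _ else WCst 0.
have cf n : conj_free (Y n) by case: n.
have ev (V : normedModType R) (v : V) (w : nat -> V) :
    w 0%N = v -> (forall n, w n.+1 = 0) -> series w @ \oo --> v.
  move=> w0 wS; rewrite -w0 -[w 0%N]addr0; apply: cvg_series_cons.
  have -> : series (fun m => w m.+1) = (fun=> 0); last exact: cvg_cst.
  by apply/funext => k; rewrite seriesEnat /= big1.
have Yc : phrase_cvg Y xi 1.
  move=> z _; apply/cvg_ex; exists (cd_abs (z - xi)).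
  by apply: (ev R^o) => // n; exact: cd_abs0.
have [|nu [nucf nuc nuE]] := phrase_linear r3 A (b + xi *m A) r2 cf Yc
    (G := fun z => z - xi).
  by move=> z _; exact: ev.
exists nu, xi, 1; split=> //; first by rewrite subrr cd_abs0 ltr01.
by move=> z zr; have := nuE z zr; rewrite -addrA -mulmxDl [xi + _]addrC subrK.
Qed.

Lemma diff_affine_mx (R : realType) r (A : 'M[R]_(cd_dim r)) b (z h : CD R r) :
  (2 <= r <= 3)%N -> cd_diff (fun z : CD R r => b + z *m A) z h = h *m A.
Proof.
move=> r23; have [_ /(_ z I)[dF _]] := affine_superderivatives A b r23.
apply/rowP => m; have [_ <-] := cd_diff_coord h m dF.
pose col : CD R r := \row_i A i m.
have mulA x : (x *m A) 0 m = dot x col.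
  by rewrite mxE; apply: eq_bigr => i _; rewrite [col _ _]mxE.
have [d D] := diff_dot_affine 0 col z.
have E x : setT x -> dot (x - 0) col + b 0 m = (b + x *m A) 0 m.
  by move=> _; rewrite subr0 [RHS]mxE mulA addrC.
have db : differentiable (fun=> b 0 m : R) z by exact: (@differentiable_cst R _ R^o).
rewrite (pd_eq h openT E I (diffDf d db)) (pdD h d db) D pd_cst addr0.
by rewrite mulA.
Qed.

(** The image of a unit vector has length [c / |z - p|^2], while a limit [L] bounds it near [p] by
    [N (|L| + 1)]; points of [U] come close enough to [p] to contradict this. *)
Lemma inversion_pole_no_limit (R : realType) r (U : set (CD R r))
    (f' : CD R r -> CD R r -> CD R r) p b c B :
  (2 <= r <= 3)%N -> 0 < c -> B *m B^T = 1%:M -> closure U p ->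
  (forall z, U z -> z != p /\ f' z = cd_diff (inversion p b c B) z) ->
  ~ nonzero_limit_at U f' p.
Proof.
move=> r23 c0 BB clU f'E [L _ fL].
pose C := `|L| + 1; have C0 : 0 < C by rewrite ltr_wpDl.
have n0 : (0 < cd_dim r)%N by elim: (r) => //= m IH; rewrite addn_gt0 IH.
pose N : R := (cd_dim r)%:R; have N0 : 0 < N by rewrite ltr0n.
pose e : CD R r := delta_mx 0 (Ordinal n0).
have bd : \forall z \near p, U z -> (c / dot (z - p) (z - p)) <= N * C.
  move/cvgrPdist_le : fL => /(_ 1 ltr01).
  rewrite near_withinE; apply: filterS => z H Uz; have {}H := H Uz.
  have [zp fE] := f'E z Uz.
  have D0 : 0 < c / dot (z - p) (z - p) by rewrite divr_gt0 // dot_gt0 subr_eq0.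
  have : cd_abs (f' z e) = c / dot (z - p) (z - p).
    rewrite cd_absE fE dot_diff_inversion // dot_basis eqxx mulr1 sqrtr_sqr.
    by rewrite ger0_norm // ltW.
  move=> <-; apply: le_trans (le_cd_abs_norm _) _; rewrite ler_wpM2l ?ler0n //.
  apply: norm_le_coord => [|j]; first exact: ltW.
  have -> : f' z e 0 j = lin1_mx (f' z) (Ordinal n0) j by rewrite mxE.
  set M := lin1_mx _ in H *.
  have ce (X : 'M[R]_(cd_dim r)) k l : `|X k l| <= `|X|.
    rewrite -[`|X|]/(mx_norm X) mx_normrE.
    exact: (le_bigmax _ (fun kl => `|X kl.1 kl.2|) (k, l)).
  have -> : M (Ordinal n0) j = L (Ordinal n0) j - (L - M) (Ordinal n0) j.
    by rewrite !mxE; ring.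
  apply: le_trans (ler_normB _ _) _; apply: lerD; first exact: ce.
  exact: le_trans (ce _ _ _) H.
(* Within this distance of [p] the scale [c / |z - p|^2] exceeds [N C + 1]. *)
pose eps := Num.sqrt (c / (N * C + 1)).
have NC : 0 < N * C + 1 by rewrite ltr_wpDl // mulr_ge0 // ltW.
have e0 : 0 < eps by rewrite sqrtr_gt0 divr_gt0.
have pe : cd_abs (p - p) < eps by rewrite subrr cd_abs0.
have nB := filterI bd (open_nbhs_nbhs (conj (@open_cd_ball R r p eps) pe)).
have [z [Uz [/= zb ze]]] := clU _ (nB _).
have D0 : 0 < dot (z - p) (z - p) by rewrite dot_gt0 subr_eq0; case: (f'E z Uz).
have Dc : dot (z - p) (z - p) < c / (N * C + 1).
  rewrite -sqr_cd_abs -[ltRHS]sqr_sqrtr ?divr_ge0 ?ltW //.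
  by rewrite ltr_pXn2r ?nnegrE ?cd_abs_ge0 // ltW.
have := zb Uz; rewrite ler_pdivrMr // => h.
move: Dc; rewrite ltr_pdivlMr // => h2.
have : dot (z - p) (z - p) < 0 by lra.
by rewrite ltNge dot_ge0.
Qed.

Lemma pseudoconformal_extension (R : realType) (r : nat)
    (U S : set (CD R r)) (f : CD R r -> CD R r) (f' : CD R r -> CD R r -> CD R r) :
  (2 <= r <= 3)%N -> domain U -> S `<=` closure U -> pseudoconformal U f f' ->
  (forall zeta, S zeta -> nonzero_limit_at U f' zeta) ->
  exists W F F', [/\ domain W, U `|` S `<=` W, pseudoconformal W F F' &
    forall z, U z -> F z = f z].
Proof.
move=> r23 [oU cU U0] SclU pf limS; have [x0 Ux0] := U0.
suff [G [F [F' [oG USG pF FE]]]] : exists G F F', [/\ open G, U `|` S `<=` G,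
    pseudoconformal G F F' & forall z, U z -> F z = f z].
  have [W [oW cW W0 USW WG]] := connected_thickening oU cU U0 SclU oG USG.
  by exists W, F, F'; split => //; exact: pseudoconformal_subset pF.
have det0 := pseudoconformal_det pf Ux0.
have [[A [b fE]]|[p [b [c [B [c0 BB fE]]]]]] := pseudoconformal_moebius r23 oU cU U0 pf.
  (* The derivative of an affine map is the same everywhere, so all conditions, the sign of the
     determinant included, are inherited from [x0]. *)
  pose F (z : CD R r) : CD R r := b + z *m A.
  have sF := affine_superderivatives A b r23.
  have dF z : differentiable F z by have [_ /(_ z I)[]] := sF.
  have f'F z : cd_diff F z = f' x0.
    rewrite (diff_eq_on oU pf fE Ux0 (dF x0)); apply/funext => h.
    by rewrite !diff_affine_mx.
  exists setT, F, (cd_diff F); split => //; last by move=> z /fE.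
    exact: openT.
  exists (fun _ _ => 0) => // z _; rewrite f'F.
  by have [dzb _ /(_ x0 Ux0)[_ ? ? ?]] := pf; split.
have dI z (zp : z != p) := inversion_differentiable b c B r23 zp.
have fI z : U z -> f z = inversion p b c B z by move=> /fE[].
have f'I z : U z -> z != p /\ f' z = cd_diff (inversion p b c B) z.
  move=> Uz; have [zp _] := fE z Uz; split => //.
  exact: (diff_eq_on oU pf fI Uz (dI z zp)).
exists [set z | z != p], (inversion p b c B), (cd_diff (inversion p b c B)).
split.
- exact: open_punctured.
- move=> z [/f'I[]//|Sz]; apply/eqP => zp; move: (limS z Sz); rewrite zp.
  apply: (inversion_pole_no_limit r23 c0 BB _ f'I) => //.
  by rewrite -zp; exact: SclU.
(* The sign of [det B] does not depend on the point and is read off from the derivative of [f] at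
   [x0]. *)
- apply: inversion_pseudoconformal => //.
  have [x0p fx0] := f'I x0 Ux0; move: det0; rewrite fx0 det_diff_inversion //.
  by rewrite oppr_gt0 pmulr_rlt0 // exprn_gt0 // divr_gt0 // dot_gt0 subr_eq0.
- by move=> z /fI.
Qed.

Local Close Scope ring_scope.

Theorem theorem42 (R : realType) (r : nat) (r_HO : r = 2 \/ r = 3)
    (U : set (CD R r)) (f : CD R r -> CD R r)
    (f' : CD R r -> CD R r -> CD R r) (S : set (CD R r)) :
  domain U ->
  pseudoconformal_hypersurface S -> S `<=` boundary U ->
  pseudoconformal U f f' ->
  (forall zeta, S zeta -> nonzero_limit_at U f' zeta) ->
  exists (W : set (CD R r)) (F : CD R r -> CD R r)
         (F' : CD R r -> CD R r -> CD R r),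
    [/\ domain W, U `|` S `<=` W, pseudoconformal W F F' &
        forall z, U z -> F z = f z].
Proof.
move=> dU _ SU pf limS; apply: pseudoconformal_extension pf limS => //.
  by case: r_HO => ->.
by move=> z /SU[].
Qed.
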